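(* Let $f$ be a probability density on $\mathbb{R}^k$, let $\phi:\mathbb{R}^k\to\mathbb{R}$ with $I=\int\phi(x)f(x)\,dx$ well-defined and finite, and let $T:\mathbb{R}^k\to\mathbb{R}^p$ and $h:\mathbb{R}^k\to\mathbb{R}_+$ define the exponential family $f_\theta(x)=\exp(\theta^T T(x)-A(\theta))h(x)$, where $h(x)>0$ whenever $\phi(x)f(x)\ne0$. Let $$K(\theta)=\int\frac{\phi^4(x)f^4(x)}{f_\theta^3(x)}\,dx,\qquad V(\theta)=\int\frac{\phi^2(x)f^2(x)}{f_\theta(x)}\,dx-I^2 .$$ Assume $\Theta\subseteq \operatorname{int}\{\theta\in\mathbb{R}^p\mid K(\theta)<\infty\}$ is nonempty, convex, and compact, and put $V^\star=\min_{\theta\in\Theta}V(\theta)$. Define $D=\max_{\theta_1,\theta_2\in\Theta}\|\theta_1-\theta_2\|_2$ and $$G^2=\sup_{\theta\in\Theta}\mathbf{E}_{X\sim f_\theta}\left\|(\nabla A(\theta)-T(X))\frac{\phi^2(X)f^2(X)}{f_\theta^2(X)}\right\|_2^2 .$$ Let $C>0$ and $\theta_1\in\Theta$, and let $(\theta_n)_{n\ge1}$, $(X_n)_{n\ge1}$, $(\hat I_n^{\mathrm{AMC}})_{n\ge1}$ be generated by the Convex AdaMC algorithm with parameters $C$ and $\theta_1$ (defined in the context). Then $G<\infty$, and for every $n\ge1$ the estimator $\hat I^{\mathrm{AMC}}_n$ is unbiased, i.e. $\mathbf{E}\,\hat I^{\mathrm{AMC}}_n=I$, and satisfies $$\frac1n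 V^\star\le \mathrm{Var}(\hat I^{\mathrm{AMC}}_n)\le\frac1n V^\star+\left(\frac{D^2}{2C}+CG^2\right)\frac{1}{n^{3/2}} .$$
   Context: All functions ($f$, $\phi$, $T$, $h$) are Borel measurable and integrals are with respect to Lebesgue measure on $\mathbb{R}^k$; $\operatorname{int}$ denotes the interior. The log-normalizer $A:\mathbb{R}^p\to\mathbb{R}\cup\{\infty\}$ is $$A(\theta)=\log\int \exp(\theta^T T(x))h(x)\,dx;$$ in particular $A$ never takes the value $-\infty$ ($h$ is not zero almost everywhere). When $A(\theta)=\infty$ one sets $f_\theta=0$ and $V(\theta)=K(\theta)=\infty$. Integrands such as $\phi^2f^2/f_\theta$ and $\phi^4f^4/f_\theta^3$ are taken to be $0$ at points where $\phi(x)f(x)=0$. Thus, when $A(\theta)<\infty$, $V(\theta)$ is the variance and $K(\theta)$ the fourth moment of $\phi(X)f(X)/f_\theta(X)$ for $X\sim f_\theta$. The Convex AdaMC algorithm: let $\Pi$ denote Euclidean projection onto $\Theta$, and let $C>0$ and $\theta_1\in\Theta$ (deterministic) be given. For $n=1,2,\dots$: - $X_n\sim f_{\theta_n}$, meaning that conditionally on $\theta_1,\dots,\theta_n,X_1,\dots,X_{n-1}$ the random vector $X_n$ has density $f_{\theta_n}$; - $\hat I_n^{\mathrm{AMC}}=\frac1n\sum_{i=1}^n \frac{\phi(X_i)f(X_i)}{f_{\theta_i}(X_i)}$; - $g_n=(\nabla A(\theta_n)-T(X_n))\frac{\phi^2(X_n)f^2(X_n)}{f_{\theta_n}^2(X_n)}$;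 - $\theta_{n+1}=\Pi\left(\theta_n-\frac{C}{\sqrt n}\,g_n\right)$. *)

(* Defs.v *)
From HB Require Import structures.
From mathcomp Require Import all_boot all_order all_algebra.
From mathcomp Require Import all_classical all_reals all_analysis.

Set Implicit Arguments.
Unset Strict Implicit.
Unset Printing Implicit Defensive.

Import Order.TTheory GRing.Theory Num.Theory.
Import numFieldNormedType.Exports.

Local Open Scope classical_set_scope.
Local Open Scope ring_scope.

(* Points of the sample space R^k are k-tuples, which carry the product (that
   is, Borel) sigma-algebra; parameters in R^p are row vectors, which carry the
   usual topology. *)

Definition tcons {R : realType} {k : nat} (z : R * k.-tuple R) : k.+1.-tuple R :=
  cons_tuple z.1 z.2.

Lemma measurable_tcons {R : realType} {k : nat} :
  measurable_fun setT (@tcons R k).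
Proof. exact: (measurable_cons measurable_fst measurable_snd). Qed.

Section lebesgue_tuple_step.
Context {R : realType} {k : nat}.
Context (m : {sigma_finite_measure set (k.-tuple R) -> \bar R}).
Local Open Scope ereal_scope.

Definition lebesgue_tupleS : set (k.+1.-tuple R) -> \bar R :=
  pushforward (@lebesgue_measure R \x m) (@tcons R k).

Let lebesgue_tupleS0 : lebesgue_tupleS set0 = 0.
Proof. by rewrite /lebesgue_tupleS /pushforward preimage_set0 measure0. Qed.

Let lebesgue_tupleS_ge0 A : 0 <= lebesgue_tupleS A.
Proof. exact: integral_ge0. Qed.

Let lebesgue_tupleS_sigma_additive : semi_sigma_additive lebesgue_tupleS.
Proof.
move=> F mF tF mUF; rewrite /lebesgue_tupleS /pushforward preimage_bigcup.
apply: measure_semi_sigma_additive.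
- by move=> n; rewrite -[X in measurable X]setTI; exact: measurable_tcons.
- apply/trivIsetP => /= i j _ _ ij; rewrite -preimage_setI.
  by move/trivIsetP : tF => /(_ _ _ _ _ ij) ->//; rewrite preimage_set0.
- by rewrite -preimage_bigcup -[X in measurable X]setTI; exact: measurable_tcons.
Qed.

HB.instance Definition _ := isMeasure.Build _ _ _ lebesgue_tupleS
  lebesgue_tupleS0 lebesgue_tupleS_ge0 lebesgue_tupleS_sigma_additive.

Let lebesgue_tupleS_sigma_finite : sigma_finite setT lebesgue_tupleS.
Proof.
have /sigma_finiteP[F [TF ndF Foo]] := sigma_finiteT (@lebesgue_measure R).
have /sigma_finiteP[G [TG ndG Goo]] := sigma_finiteT m.
exists (fun n => [set x | F n (thead x) /\ G n [tuple of behead x]]).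
  rewrite predeqE => x; split=> // _.
  have [i _ Fix] : (\bigcup_i F i) (thead x) by rewrite -TF.
  have [j _ Gjx] : (\bigcup_i G i) [tuple of behead x] by rewrite -TG.
  exists (maxn i j) => //; split.
  - by move: (thead x) Fix; exact/subsetPset/ndF/leq_maxl.
  - by move: [tuple of behead x] Gjx; exact/subsetPset/ndG/leq_maxr.
move=> n; have [mF Fnoo] := Foo n; have [mG Gnoo] := Goo n; split.
  apply: measurableI; rewrite -[X in measurable X]setTI.
    exact: (@measurable_tnth _ _ k.+1 ord0).
  exact: measurable_behead.
rewrite /lebesgue_tupleS /pushforward.
rewrite (_ : _ @^-1` _ = F n `*` G n); last first.
  apply/seteqP; split=> -[a t] /= [Fa Gt]; split => //.
    by rewrite (_ : t = [tuple of behead (tcons (a, t))])//; exact/val_inj.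
  by rewrite (_ : [tuple of _] = t)//; exact/val_inj.
by rewrite product_measure1E// lte_mul_pinfty// ge0_fin_numE.
Qed.

HB.instance Definition _ := Measure_isSigmaFinite.Build _ _ _ lebesgue_tupleS
  lebesgue_tupleS_sigma_finite.

End lebesgue_tuple_step.

Section lebesgue_tuple.
Context {R : realType}.

(* Lebesgue measure on R^k, as an iterated product. *)
Fixpoint lebesgue_tuple (k : nat) :
    {sigma_finite_measure set (k.-tuple R) -> \bar R} :=
  match k with
  | 0%N => \d_([tuple] : 0.-tuple R)
  | k'.+1 => lebesgue_tupleS (lebesgue_tuple k')
  end.

Lemma lebesgue_tuple_box (k : nat) (A : 'I_k -> set R) :
  (forall i, measurable (A i)) ->
  lebesgue_tuple k [set x | forall i, A i (tnth x i)] =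
  (\prod_(i < k) lebesgue_measure (A i))%E.
Proof.
elim: k A => [|k IH] A mA.
  by rewrite big_ord0 /= diracE mem_set//= => -[].
rewrite big_ord_recl -IH//=.
rewrite /lebesgue_tupleS /pushforward.
rewrite (_ : _ @^-1` _ =
    A ord0 `*` [set x | forall i, A (lift ord0 i) (tnth x i)]); last first.
  apply/seteqP; split=> -[a t] /=.
    by move=> H; split=> [|i]; [exact: (H ord0)|rewrite -(tnthS a); exact: H].
  move=> [Aa At] i; have [j ->|->//] := unliftP ord0 i.
  by rewrite tnthS; exact: At.
rewrite product_measure1E//; first exact: mA.
rewrite (_ : [set x | _] = \bigcap_(i : 'I_k)
    ((fun x : k.-tuple R => tnth x i) @^-1` A (lift ord0 i))); last first.
  by apply/seteqP; split=> x /= H i => [_|]; exact: H.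
apply: fin_bigcap_measurable => // i _.
by rewrite -[X in measurable X]setTI; exact: (measurable_tnth i).
Qed.

End lebesgue_tuple.

Section parameter_space.
Context {R : realType} {p : nat}.
Implicit Types (u v t : 'rV[R]_p) (Theta : set 'rV[R]_p).

Definition borel_rV : Type := g_sigma_algebraType (@open 'rV[R]_p).
HB.instance Definition _ := Measurable.on borel_rV.

Definition dotv u v : R := \sum_(i < p) u ord0 i * v ord0 i.

(* The library norm of row vectors is the sup norm. *)
Definition enorm u : R := Num.sqrt (dotv u u).

Definition gradient (g : 'rV[R]_p -> R) t : 'rV[R]_p :=
  \row_(i < p) 'D_(delta_mx ord0 i) g t.

Definition is_projection Theta t y :=
  Theta y /\ forall z, Theta z -> enorm (t - y) <= enorm (t - z).

Definition diameter Theta : R :=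
  sup [set enorm (t.1 - t.2) | t in Theta `*` Theta].

End parameter_space.
Arguments borel_rV : clear implicits.

Section exponential_family.
Context {R : realType} {k p : nat}.
Context (T : k.-tuple R -> 'rV[R]_p) (h phi f : k.-tuple R -> R).
Implicit Types (t : 'rV[R]_p) (x : k.-tuple R) (Theta : set 'rV[R]_p).
Local Notation mu := (@lebesgue_tuple R k).

Definition log_normalizer t : \bar R :=
  lne (\int[mu]_x (expR (dotv t (T x)) * h x)%:E).

Definition expfam t x : R :=
  if log_normalizer t is a%:E then expR (dotv t (T x) - a) * h x else 0.

Definition grad_log_normalizer t : 'rV[R]_p :=
  gradient (fun s => fine (log_normalizer s)) t.

Definition target : R := \int[mu]_x (phi x * f x).

(* Variance and fourth moment of phi(X) f(X) / f_t(X) for X of density f_t =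
   expfam t. As x / 0 = 0, the quotients below vanish where phi x * f x = 0. *)
Definition weight_fourth_moment t : \bar R :=
  if log_normalizer t == +oo%E then +oo%E
  else (\int[mu]_x (phi x ^+ 4 * f x ^+ 4 / expfam t x ^+ 3)%:E)%E.

Definition weight_variance t : \bar R :=
  if log_normalizer t == +oo%E then +oo%E
  else (\int[mu]_x (phi x ^+ 2 * f x ^+ 2 / expfam t x)%:E
        - (target ^+ 2)%:E)%E.

Definition amc_gradient t x : 'rV[R]_p :=
  (phi x ^+ 2 * f x ^+ 2 / expfam t x ^+ 2)
    *: (grad_log_normalizer t - T x).

Definition min_variance Theta : \bar R :=
  ereal_inf [set weight_variance t | t in Theta].

(* The integral is the expectation of the squared norm of the stochastic
   gradient under the density expfam t. *)
Definition max_sq_gradient Theta : \bar R :=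
  ereal_sup [set (\int[mu]_x
    (enorm (amc_gradient t x) ^+ 2 * expfam t x)%:E)%E | t in Theta].

End exponential_family.

Section convex_adamc.
Context {R : realType} {k p : nat}.
Context (T : k.-tuple R -> 'rV[R]_p) (h phi f : k.-tuple R -> R).
Context (Theta : set 'rV[R]_p) (C : R) (theta1 : 'rV[R]_p).
Context {d : measure_display} {Omega : measurableType d}.
Context (P : probability Omega R).
Context (X : nat -> Omega -> k.-tuple R) (theta : nat -> Omega -> 'rV[R]_p).

(* The sigma-algebra generated by theta_1, ..., theta_n, X_1, ..., X_{n-1};
   time starts at 1 and the value of a sequence at 0 is irrelevant. *)
Definition history (n : nat) : set (set Omega) :=
  <<s (\bigcup_(i in [set i | (1 <= i <= n)%N])
         preimage_set_system setT (theta i : Omega -> borel_rV R p) measurable)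
      `|` (\bigcup_(i in [set i | (1 <= i < n)%N])
         preimage_set_system setT (X i) measurable) >>.

Record convex_adamc : Prop := ConvexAdaMC {
  adamc_measurable_theta : forall n, (1 <= n)%N ->
    measurable_fun setT (theta n : Omega -> borel_rV R p) ;
  adamc_measurable_X : forall n, (1 <= n)%N -> measurable_fun setT (X n) ;
  adamc_init : forall w, theta 1%N w = theta1 ;
  (* Conditionally on the history, X_n has density f_{theta_n}. *)
  adamc_density : forall n (E : set Omega) (B : set (k.-tuple R)),
    (1 <= n)%N -> history n E -> measurable B ->
    P (E `&` X n @^-1` B) =
    (\int[P]_(w in E) \int[lebesgue_tuple k]_(x in B)
       (expfam T h (theta n w) x)%:E)%E ;
  adamc_update : forall n w, (1 <= n)%N ->
    is_projection Theta
      (theta n w - (C / Num.sqrt n%:R) *: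
         amc_gradient T h phi f (theta n w) (X n w))
      (theta n.+1 w)
}.

Definition amc_estimator (n : nat) (w : Omega) : R :=
  n%:R^-1 * \sum_(1 <= i < n.+1)
    (phi (X i w) * f (X i w) / expfam T h (theta i w) (X i w)).

End convex_adamc.

(* Main.v *)
Require Import Defs.
From HB Require Import structures.
From mathcomp Require Import all_boot all_order all_algebra.
From mathcomp Require Import all_classical all_reals all_analysis.
From mathcomp Require Import measurable_realfun ring lra.

(* The weighted samples Y_n = phi f / f_(theta_n) at X_n are unbiased given the
   past, hence pairwise uncorrelated, so the variance of the average of
   Y_1, ..., Y_n is n^-2 times the sum of the expectations of V(theta_i).  The
   lower bound follows at once, and the upper bound is the regret bound of
   projected stochastic gradient descent.

   Convexity of V is only used through a pointwise inequality.  For densities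
   f_s, f_t of the family, expR u >= 1 + u and the subgradient inequality for
   the log-normalizer A (whose gradient at t is the mean of T under f_t) give
     phi^2 f^2 / f_s >= phi^2 f^2 / f_t * (1 + <grad A(t) - T, s - t>).
   Divided by f_t and inserted at X_n into the expansion of
   |theta_n - alpha g_n - s|^2, it gives an inequality between nonnegative
   random variables, which can be integrated without integrability conditions.
   Integrated against Lebesgue measure instead, it shows that V is Lipschitz on
   Theta, so that its minimum is attained. *)

Set Implicit Arguments.
Unset Strict Implicit.
Unset Printing Implicit Defensive.

Import Order.TTheory GRing.Theory Num.Theory.
Import numFieldNormedType.Exports.

Local Open Scope classical_set_scope.
Local Open Scope ring_scope.

(** * Joint laws with a conditional density *)

(** The fourth moment enters because the squared gradient, weighted by the density, is
    [phi^4 f^4 / f_t^3] times [|grad A(t) - T|^2], and the first factor is again of exponential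
    type, with statistic [- 3 T]. Near an interior point of finiteness an exponential integral stays
    bounded even after its integrand is multiplied by [1 + |T|^2]; this one estimate controls the
    normalization, the mean of [T] and the second moment of the gradient locally, and compactness
    makes the last bound uniform. Nothing is differentiated under the integral sign: the subgradient
    inequality and a quadratic upper bound squeeze the difference quotients of [A] towards the mean
    of [T], a form that also shows the gradient measurable in the parameter. The conditional density
    is given on events only. With [Omega], carrying the sigma-algebra of the past, as the first
    factor of a product space, it becomes an integral formula for functions of the past and [X_n].
    With steps [C / sqrt i], the distances contribute at most [sqrt n D^2 / (2 C)] to the regret,
    and the noise terms [C G^2 / (2 sqrt i)] at most [sqrt n C G^2]. *)

Section density.
Context d (T : measurableType d) (R : realType) (m nu : {measure set T -> \bar R}).
Variable g : T -> R.
Hypotheses (mg : measurable_fun setT g) (g_ge0 : forall x, 0 <= g x).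
Hypothesis nuE : forall A, measurable A -> nu A = (\int[m]_(x in A) (g x)%:E)%E.
Local Open Scope ereal_scope.
Import HBNNSimple.

(** Both sides pass to increasing limits, which leaves simple functions and, by linearity,
    indicators of level sets, where [nuE] applies. *)
Lemma ge0_integral_density (F : T -> \bar R) :
  measurable_fun setT F -> (forall x, 0 <= F x) ->
  \int[nu]_x F x = \int[m]_x (F x * (g x)%:E).
Proof.
move=> mF F0.
pose h := nnsfun_approx measurableT mF.
have mgE : measurable_fun setT (EFin \o g) by exact/measurable_EFinP.
have hF x : EFin \o h^~ x @ \oo --> F x by apply: cvg_nnsfun_approx.
have hm n : measurable_fun setT (EFin \o h n).
  by apply/measurable_EFinP; exact/measurable_funP.
transitivity (lim (\int[nu]_x (EFin \o h n) x @[n --> \oo])).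
  under eq_integral => x _ do rewrite -(cvg_lim _ (hF x))//.
  apply: monotone_convergence => //.
  - by move=> n x _ /=; rewrite lee_fin.
  - by move=> x _ a b ab; rewrite lee_fin; exact/lefP/nd_nnsfun_approx.
have -> : \int[m]_x (F x * (g x)%:E) =
    lim (\int[m]_x ((EFin \o h n) x * (g x)%:E) @[n --> \oo]).
  have Fg x : F x * (g x)%:E = lim ((EFin \o h n) x * (g x)%:E @[n --> \oo]).
    by apply/esym/cvg_lim => //; apply: cvgeZr => //; exact: hF.
  under eq_integral => x _ do rewrite Fg.
  apply: monotone_convergence => //.
  - by move=> n; apply: emeasurable_funM.
  - by move=> n x _ /=; rewrite mule_ge0 ?lee_fin.
  - by move=> x _ a b ab/=; rewrite lee_wpmul2r ?lee_fin//; exact/lefP/nd_nnsfun_approx.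
congr (lim (_ @ \oo)); apply/funext => n.
have mh r : measurable (h n @^-1` [set r]) by [].
transitivity (\sum_(r \in range (h n)) \int[nu]_x (r * \1_(h n @^-1` [set r]) x)%:E).
  rewrite -ge0_integral_fsum//.
  - by apply: eq_integral => x _; rewrite fsumEFin// -fimfunE.
  - by move=> r; exact/measurable_EFinP/measurable_funM.
  - by move=> r x _; rewrite nnfun_muleindic_ge0.
transitivity (\sum_(r \in range (h n))
    \int[m]_x ((r * \1_(h n @^-1` [set r]) x)%:E * (g x)%:E)).
  apply: eq_fsbigr => r _; rewrite integralZl_indic_nnsfun// integral_indic// setIT nuE//.
  transitivity (\int[m]_x (r%:E * ((\1_(h n @^-1` [set r]) x)%:E * (g x)%:E))); last first.
    by apply: eq_integral => x _; rewrite muleA.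
  (* A nonnegative simple function does not take a negative value [r], so the level set is empty and
     both sides vanish. *)
  have [r0|r0] := ltP r 0%R.
    rewrite preimage_nnfun0// integral_set0 mule0 integral0_eq// => x _.
    by rewrite indic0 mul0e mule0.
  rewrite ge0_integralZl//; last 2 first.
  - apply: emeasurable_funM => //; exact/measurable_EFinP.
  - by move=> x _; rewrite mule_ge0// lee_fin.
  congr (_ * _); rewrite integral_mkcond; apply: eq_integral => x _.
  by rewrite patchE indicE; case: (x \in _); rewrite ?mul1e ?mul0e.
rewrite -ge0_integral_fsum//.
- apply: eq_integral => x _ /=; rewrite -ge0_mule_fsuml//; last first.
    by move=> r; rewrite nnfun_muleindic_ge0.
  by rewrite fsumEFin// -fimfunE.
- by move=> r; apply: emeasurable_funM => //; exact/measurable_EFinP/measurable_funM.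
- by move=> r x _; rewrite mule_ge0// ?nnfun_muleindic_ge0// lee_fin.
Qed.

End density.

Section joint_density.
Context d d1 d2 (Omega : measurableType d) (S : measurableType d1)
  (Y : measurableType d2) (R : realType) (P : probability Omega R)
  (m : {sigma_finite_measure set Y -> \bar R})
  (eta : {mfun Omega >-> S}) (X : {mfun Omega >-> Y}).
Variable q : S * Y -> R.
Hypotheses (mq : measurable_fun setT q) (q_ge0 : forall z, 0 <= q z).
Local Open Scope ereal_scope.
Hypothesis PE : forall E B, measurable E -> measurable B ->
  P (eta @^-1` E `&` X @^-1` B) =
  \int[P]_(w in eta @^-1` E) \int[m]_(y in B) (q (eta w, y))%:E.

Let mqE : measurable_fun setT (EFin \o q). Proof. exact/measurable_EFinP. Qed.

Let joint w := (eta w, X w).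
Let mjoint : measurable_fun setT joint.
Proof. exact: measurable_fun_pair. Qed.
HB.instance Definition _ := isMeasurableFun.Build _ _ _ _ joint mjoint.

Let nu A := \int[distribution P eta \x m]_(z in A) (q z)%:E.
Let nu0 : nu set0 = 0. Proof. by rewrite /nu integral_set0. Qed.
Let nu_ge0 A : 0 <= nu A.
Proof. by apply: integral_ge0 => z _; rewrite lee_fin. Qed.
Let nu_sigma : semi_sigma_additive nu.
Proof. by apply: semi_sigma_additive_nng_induced => // z; rewrite lee_fin. Qed.
HB.instance Definition _ := isMeasure.Build _ _ _ nu nu0 nu_ge0 nu_sigma.

(** Rectangles form a pi-system that generates the product sigma-algebra, and on a rectangle the
    claim is [PE] after Tonelli. The total mass is finite, so the constant sequence [setT] serves as
    the exhaustion. *)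
Let joint_law A : measurable A -> distribution P joint A = nu A.
Proof.
pose C : set (set (S * Y)) :=
  [set A `*` B | A in measurable & B in measurable].
apply: (measure_unique C (fun=> setT)).
- by rewrite measurable_prod_measurableType.
- move=> _ _ [X1 mX1 [X2 mX2 <-]] [Y1 mY1 [Y2 mY2 <-]].
  rewrite -setXI; exists (X1 `&` Y1); first exact: measurableI.
  by exists (X2 `&` Y2) => //; exact: measurableI.
- by move=> _; exists setT => //; exists setT => //; rewrite setXTT.
- by rewrite bigcup_const.
- move=> _ [E mE [B mB <-]].
  transitivity (P (eta @^-1` E `&` X @^-1` B)) => //; rewrite PE//.
  transitivity (nu (E `*` B)) => //.
  pose qEB := (fun z => (q z)%:E) \_ (E `*` B).
  have qEB0 z : 0 <= qEB z by rewrite /qEB patchE; case: ifP => // _; rewrite lee_fin.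
  have mqEB : measurable_fun setT qEB.
    by apply/(measurable_restrictT _ _).1; [exact: measurableX|exact: measurable_funTS].
  rewrite /nu [RHS]integral_mkcond -/qEB fubini_tonelli1// ge0_integral_pushforward//; last 2 first.
  - exact: measurable_fun_fubini_tonelli_F.
  - by move=> s _; apply: integral_ge0.
  rewrite preimage_setT [LHS]integral_mkcond; apply: eq_integral => w _ /=.
  rewrite patchE /fubini_F /qEB; case: ifPn => Ew.
    rewrite [LHS]integral_mkcond; apply: eq_integral => y _; rewrite !patchE in_setX/=.
    by rewrite (_ : eta w \in E)//; move: Ew; rewrite !inE.
  rewrite integral0_eq// => y _; rewrite patchE in_setX/= (_ : eta w \in E = false)//.
  by apply/negbTE; apply: contra Ew; rewrite !inE.
- by move=> _; rewrite (le_lt_trans (probability_le1 _ _)) ?ltry.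
Qed.

Lemma ge0_integral_joint_density (F : S * Y -> \bar R) :
  measurable_fun setT F -> (forall z, 0 <= F z) ->
  \int[P]_w F (eta w, X w) = \int[distribution P eta \x m]_z (F z * (q z)%:E).
Proof.
move=> mF F0; rewrite -(ge0_integral_density mq q_ge0 joint_law)//.
by rewrite ge0_integral_pushforward.
Qed.

(** Multiplication by the nonnegative [q] commutes with taking positive and negative parts, so the
    nonnegative case applies to each part without any integrability. *)
Lemma integral_joint_density (F : S * Y -> \bar R) : measurable_fun setT F ->
  \int[P]_w F (eta w, X w) = \int[distribution P eta \x m]_z (F z * (q z)%:E).
Proof.
move=> mF; rewrite integralE [RHS]integralE.
have q0 z : 0 <= (q z)%:E by rewrite lee_fin.
congr (_ - _).
  transitivity (\int[P]_w F^\+ (eta w, X w)).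
    by apply: eq_integral => w _; rewrite !funeposE.
  rewrite ge0_integral_joint_density//; last exact: measurable_funepos.
  by apply: eq_integral => z _; rewrite !funeposE maxe_pMl// mul0e.
transitivity (\int[P]_w F^\- (eta w, X w)).
    by apply: eq_integral => w _; rewrite !funenegE.
rewrite ge0_integral_joint_density//; last exact: measurable_funeneg.
by apply: eq_integral => z _; rewrite !funenegE maxe_pMl// mul0e mulNe.
Qed.

End joint_density.

(** * Exponential bounds and row vectors *)

Section exponential_bounds.
Context {R : realType}.
Implicit Types u c : R.

(** [1 + v <= expR v] at [v = - u] gives [expR u - 1 <= u * expR u], so the left side is at most
    [u * (expR u - 1)], which is of second order. *)
Lemma expR_le_taylor1 u : expR u - 1 - u <= u ^+ 2 * expR `|u|.
Proof.
have e1 := expR_ge1Dx u; have e2 := expR_ge1Dx (- u); rewrite expRN in e2.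
have eu0 := expR_gt0 u.
have {e2} e2 : (1 - u) * expR u <= 1 by rewrite -ler_pdivlMr// div1r.
have [u0|u0] := leP 0 u.
  rewrite ger0_norm//.
  have : 0 <= u * expR u * u by rewrite !mulr_ge0// ltW.
  have : u * (expR u - 1 - u) >= 0 by rewrite mulr_ge0//; lra.
  nra.
rewrite ltr0_norm//.
have : 1 <= expR (- u) by rewrite -expR0 ler_expR; lra.
nra.
Qed.

(** The constant comes from squaring [c * |u| / 2 <= expR (c * |u| / 2)]. *)
Lemma sqr_le_expR c u : 0 < c -> u ^+ 2 <= 4 / c ^+ 2 * expR (c * `|u|).
Proof.
move=> c0; rewrite -(real_normK (num_real u)).
have := expR_ge1Dx (c * `|u| / 2).
have -> : expR (c * `|u|) = expR (c * `|u| / 2) ^+ 2.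
  by rewrite expr2 -expRD; congr expR; field.
have cu : 0 <= c * `|u| by rewrite mulr_ge0// ltW.
set e := expR _ => h.
have : (c * `|u|) ^+ 2 <= 4 * e ^+ 2 by nra.
rewrite exprMn mulrC => h2.
by rewrite mulrAC ler_pdivlMr ?exprn_gt0// mulrC -[_ * c ^+ 2]mulrC mulrC.
Qed.

End exponential_bounds.

Section row_vectors.
Context {R : realType} {p : nat}.
Implicit Types (u v t y : 'rV[R]_p) (c : R) (i : 'I_p).

Lemma dotvDl u v y : dotv (u + v) y = dotv u y + dotv v y.
Proof. by rewrite /dotv -big_split; apply: eq_bigr => i _; rewrite !mxE mulrDl. Qed.

Lemma dotvZl c u y : dotv (c *: u) y = c * dotv u y.
Proof. by rewrite /dotv mulr_sumr; apply: eq_bigr => i _; rewrite !mxE mulrA. Qed.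

Lemma dotvC u v : dotv u v = dotv v u.
Proof. by apply: eq_bigr => i _; rewrite mulrC. Qed.

Lemma dotvNl u y : dotv (- u) y = - dotv u y.
Proof. by rewrite -scaleN1r dotvZl mulN1r. Qed.

Lemma dotvBl u v y : dotv (u - v) y = dotv u y - dotv v y.
Proof. by rewrite dotvDl dotvNl. Qed.

Lemma dotvZr c u y : dotv u (c *: y) = c * dotv u y.
Proof. by rewrite dotvC dotvZl dotvC. Qed.

Lemma dotvNr u y : dotv y (- u) = - dotv y u.
Proof. by rewrite dotvC dotvNl dotvC. Qed.

Lemma dotvDr u v y : dotv y (u + v) = dotv y u + dotv y v.
Proof. by rewrite dotvC dotvDl !(dotvC y). Qed.

Lemma dotvBr u v y : dotv y (u - v) = dotv y u - dotv y v.
Proof. by rewrite dotvC dotvBl !(dotvC y). Qed.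

Lemma dotv_delta i y : dotv (delta_mx ord0 i) y = y ord0 i.
Proof.
rewrite /dotv (bigD1 i)//= big1 ?addr0 => [|j ji]; rewrite !mxE !eqxx/= ?mul1r//.
by rewrite (negbTE ji) mul0r.
Qed.

Lemma dotv_ge0 u : 0 <= dotv u u.
Proof. by apply: sumr_ge0 => i _; rewrite -expr2 sqr_ge0. Qed.

Lemma sqr_enorm u : enorm u ^+ 2 = dotv u u.
Proof. by rewrite sqr_sqrtr// dotv_ge0. Qed.

Lemma enorm_ge0 u : 0 <= enorm u. Proof. exact: sqrtr_ge0. Qed.

Lemma coord_le_norm y i : `|y ord0 i| <= `|y|.
Proof.
by rewrite [leRHS]mx_normrE (le_trans _ (le_bigmax _ _ (ord0, i))).
Qed.

Lemma norm_le_sup c y : 0 <= c -> (forall i, `|y ord0 i| <= c) -> `|y| <= c.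
Proof.
move=> c0 yc; rewrite [leLHS]mx_normrE; apply/bigmax_leP; split => // -[i j] _ /=.
by rewrite ord1.
Qed.

Lemma norm_dotv_le u v : `|dotv u v| <= p%:R * `|u| * `|v|.
Proof.
rewrite (le_trans (ler_norm_sum _ _ _))//.
rewrite (@le_trans _ _ (\sum_(i < p) `|u| * `|v|))//.
  by apply: ler_sum => i _; rewrite normrM ler_pM// coord_le_norm.
by rewrite sumr_const card_ord -mulrA mulr_natl.
Qed.

Lemma dotv_le_norm u : dotv u u <= p%:R * `|u| ^+ 2.
Proof. by rewrite (le_trans (ler_norm _))// (le_trans (norm_dotv_le _ _))// expr2 mulrA. Qed.

Lemma norm_le_dotv u : `|u| ^+ 2 <= dotv u u.
Proof.
rewrite -[leRHS]sqr_sqrtr ?dotv_ge0// ler_sqr ?nnegrE ?sqrtr_ge0//.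
apply: norm_le_sup; rewrite ?sqrtr_ge0// => i.
rewrite -(sqrtr_sqr (u ord0 i)) ler_wsqrtr// expr2 /dotv (bigD1 i)//= lerDl.
by apply: sumr_ge0 => j _; rewrite -expr2 sqr_ge0.
Qed.

Lemma norm_deltaE i : `|delta_mx ord0 i : 'rV[R]_p| <= 1.
Proof.
apply: norm_le_sup => // j; rewrite !mxE; case: (_ && _); by rewrite ?normr1 ?normr0.
Qed.

(* The exponents are the centre and the vertices of the cross-polytope of
   radius c around t, so that a ball of parameters is controlled by finitely
   many of them. *)
Definition cross_expR c t y : R :=
  expR (dotv t y) +
  \sum_(i < p) (expR (dotv (t + c *: delta_mx ord0 i) y) +
                expR (dotv (t - c *: delta_mx ord0 i) y)).

(** The sup norm of [y] is attained at some coordinate [i], and the vertex in direction [i] with the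
    sign of [y_i] contributes exactly the left side. *)
Lemma cross_expR_ge c t y : 0 <= c ->
  expR (dotv t y) * expR (c * `|y|) <= cross_expR c t y.
Proof.
move=> c0; rewrite /cross_expR.
have s0 : 0 <= \sum_(i < p) (expR (dotv (t + c *: delta_mx ord0 i) y) +
                expR (dotv (t - c *: delta_mx ord0 i) y)).
  by apply: sumr_ge0 => i _; rewrite addr_ge0// expR_ge0.
(* The centre term settles [y = 0]; this includes [p = 0], where there is no coordinate to
   choose. *)
have [y0|y0] := eqVneq `|y| 0.
  by rewrite y0 mulr0 expR0 mulr1 lerDl.
have [[i0 i]/= yi] := mx_norm_neq0 y0; rewrite ord1 in yi.
rewrite [X in c * X](yi : `|y| = _) -expRD.
rewrite (bigD1 i)//= (@le_trans _ _ (expR (dotv (t + c *: delta_mx ord0 i) y) +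
    expR (dotv (t - c *: delta_mx ord0 i) y)))//; last first.
  set S := (X in _ <= _ + (_ + X)); have S0 : 0 <= S.
    by apply: sumr_ge0 => j _; rewrite addr_ge0// expR_ge0.
  by have := expR_ge0 (dotv t y); lra.
rewrite dotvBl dotvDl dotvZl dotv_delta.
have [yi0|yi0] := leP 0 (y ord0 i).
  by rewrite ger0_norm// lerDl expR_ge0.
by rewrite ltr0_norm// mulrN lerDr expR_ge0.
Qed.

(** Of the radius [(p + 1) * r], the part [p * r] pays for moving the exponent from [t0] to [t], the
    factor [p] being the price of the sup norm in [norm_dotv_le]; the remaining [r] absorbs the
    quadratic factor by [sqr_le_expR]. *)
Lemma expR_dotv_le_cross r t t0 y : 0 < r -> `|t - t0| <= r ->
  (1 + dotv y y) * expR (dotv t y) <=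
  (1 + p%:R * (4 / r ^+ 2)) * cross_expR (p.+1%:R * r) t0 y.
Proof.
move=> r0 tr.
have k0 : 0 <= 1 + p%:R * (4 / r ^+ 2).
  by rewrite addr_ge0// mulr_ge0// divr_ge0// exprn_ge0// ltW.
apply: (@le_trans _ _ ((1 + p%:R * (4 / r ^+ 2)) *
    (expR (dotv t0 y) * expR (p.+1%:R * r * `|y|)))); last first.
  by rewrite ler_wpM2l ?cross_expR_ge// mulr_ge0// ltW.
have h1 : expR (dotv t y) <= expR (dotv t0 y) * expR (p%:R * r * `|y|).
  rewrite -expRD ler_expR -lerBlDl -dotvBl (le_trans (ler_norm _))//.
  by rewrite (le_trans (norm_dotv_le _ _))// ler_wpM2r// ler_wpM2l.
have h2 : 1 + dotv y y <= (1 + p%:R * (4 / r ^+ 2)) * expR (r * `|y|).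
  rewrite mulrDl mul1r lerD//.
    by rewrite -expR0 ler_expR mulr_ge0// ltW.
  rewrite (le_trans (dotv_le_norm _))// -mulrA ler_wpM2l//.
  by have := sqr_le_expR `|y| r0; rewrite normr_id.
have -> : p.+1%:R * r * `|y| = p%:R * r * `|y| + r * `|y|.
  by rewrite -natr1; ring.
rewrite expRD (le_trans (ler_pM _ _ h2 h1)) ?expR_ge0 ?addr_ge0 ?dotv_ge0//.
by rewrite le_eqVlt; apply/orP; left; apply/eqP; ring.
Qed.

End row_vectors.

(** * Exponential integrals *)

Section measurable_dotv.
Context {R : realType} {p : nat} d (Y : measurableType d).

Lemma measurable_dotv (u v : Y -> 'rV[R]_p) :
  (forall i, measurable_fun setT (fun x => u x ord0 i)) ->
  (forall i, measurable_fun setT (fun x => v x ord0 i)) ->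
  measurable_fun setT (fun x => dotv (u x) (v x)).
Proof. by move=> mu mv; apply: measurable_sum => i; exact: measurable_funM. Qed.

Lemma measurable_expR_dotv (u v : Y -> 'rV[R]_p) :
  (forall i, measurable_fun setT (fun x => u x ord0 i)) ->
  (forall i, measurable_fun setT (fun x => v x ord0 i)) ->
  measurable_fun setT (fun x => expR (dotv (u x) (v x))).
Proof. by move=> mu mv; apply: measurableT_comp => //; exact: measurable_dotv. Qed.

End measurable_dotv.

Section exp_integral.
Context {R : realType} {p : nat} d (Y : measurableType d).
Context (m : {measure set Y -> \bar R}) (T : Y -> 'rV[R]_p) (rho : Y -> R).
Hypotheses (mT : forall i, measurable_fun setT (fun x => T x ord0 i))
  (mrho : measurable_fun setT rho) (rho_ge0 : forall x, 0 <= rho x).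

Definition exp_integral t : \bar R :=
  (\int[m]_x (expR (dotv t (T x)) * rho x)%:E)%E.

Let mexp t : measurable_fun setT (fun x => expR (dotv t (T x)) * rho x).
Proof. by apply: measurable_funM => //; exact: measurable_expR_dotv. Qed.

Lemma measurable_exp_moment t : measurable_fun setT
  (fun x => (1 + dotv (T x) (T x)) * expR (dotv t (T x)) * rho x).
Proof.
apply: measurable_funM => //; apply: measurable_funM.
  by apply: measurable_funD => //; exact: measurable_dotv.
exact: measurable_expR_dotv.
Qed.

Lemma exp_moment_ge0 t x :
  0 <= (1 + dotv (T x) (T x)) * expR (dotv t (T x)) * rho x.
Proof. by rewrite !mulr_ge0 ?expR_ge0// addr_ge0// dotv_ge0. Qed.

(** The radius is chosen so that the vertices of the cross-polytope lie at distance at most [e / 2]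
    from [t0], where the integral is finite; these finitely many integrals dominate the whole ball
    of radius [r]. *)
Lemma exp_integral_locally_bounded (t0 : 'rV[R]_p) :
  (\forall t \near t0, (exp_integral t < +oo)%E) ->
  exists2 r : R, 0 < r & exists B : R, forall t, `|t - t0| <= r ->
    (\int[m]_x ((1 + dotv (T x) (T x)) * expR (dotv t (T x)) * rho x)%:E
       <= B%:E)%E.
Proof.
move=> /nbhs_ballP[e /= e0 et0].
pose r := e / 2 / p.+1%:R.
have r0 : 0 < r by rewrite !divr_gt0.
have rE : p.+1%:R * r = e / 2 by rewrite mulrC divfK ?pnatr_eq0.
exists r => //.
pose c := 1 + p%:R * (4 / r ^+ 2).
have c0 : 0 <= c by rewrite addr_ge0// mulr_ge0// divr_ge0// exprn_ge0// ltW.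
have fin t : `|t - t0| <= e / 2 -> (exp_integral t < +oo)%E.
  move=> tt; apply: et0; rewrite -ball_normE/= distrC (le_lt_trans tt)//.
  by rewrite ltr_pdivrMr// ltr_pMr// ltr1n.
have fin_vertex i (s : R) : `|s| = 1 ->
    (exp_integral (t0 + (s * (p.+1%:R * r)) *: delta_mx ord0 i) < +oo)%E.
  move=> s1; apply: fin; rewrite addrC addKr normrZ normrM s1 mul1r rE.
  by rewrite ger0_norm ?divr_ge0 ?(ltW e0)// ler_piMr ?norm_deltaE// divr_ge0// ltW.
have crossoo : (\int[m]_x (cross_expR (p.+1%:R * r) t0 (T x) * rho x)%:E < +oo)%E.
  have mi i s : measurable_fun setT (fun x => (expR (dotv (t0 + s *: delta_mx ord0 i) (T x)) * rho x)%:E).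
    exact/measurable_EFinP.
  under eq_integral do rewrite /cross_expR mulrDl EFinD mulr_suml -sumEFin.
  rewrite ge0_integralD//; last 4 first.
  - by move=> x _; rewrite lee_fin mulr_ge0// expR_ge0.
  - exact/measurable_EFinP.
  - by move=> x _; apply: sume_ge0 => i _; rewrite lee_fin mulr_ge0// addr_ge0 ?expR_ge0.
  - apply: emeasurable_sum => i; apply/measurable_EFinP; apply: measurable_funM => //.
    by apply: measurable_funD; apply: measurable_expR_dotv.
  rewrite lte_add_pinfty//; first by apply: fin; rewrite subrr normr0 divr_ge0// ltW.
  rewrite ge0_integral_sum//; last 2 first.
  - move=> i; apply/measurable_EFinP; apply: measurable_funM => //.
    by apply: measurable_funD; apply: measurable_expR_dotv.
  - by move=> i x _; rewrite lee_fin mulr_ge0// addr_ge0 ?expR_ge0.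
  apply: lte_sum_pinfty => i _.
  have v1 := fin_vertex i 1 (normr1 _); have v2 := fin_vertex i (-1) (normrN1 _).
  rewrite mul1r in v1; rewrite mulN1r scaleNr in v2.
  under eq_integral do rewrite mulrDl EFinD.
  have mN : measurable_fun setT (fun x =>
      (expR (dotv (t0 - (p.+1%:R * r) *: delta_mx ord0 i) (T x)) * rho x)%:E).
    exact/measurable_EFinP.
  rewrite ge0_integralD//; first exact: lte_add_pinfty v1 v2.
  - by move=> x _; rewrite lee_fin mulr_ge0// expR_ge0.
  - by move=> x _; rewrite lee_fin mulr_ge0// expR_ge0.
have cross0 x : 0 <= cross_expR (p.+1%:R * r) t0 (T x).
  by rewrite addr_ge0 ?expR_ge0// sumr_ge0// => i _; rewrite addr_ge0 ?expR_ge0.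
have mcross : measurable_fun setT (fun x => cross_expR (p.+1%:R * r) t0 (T x) * rho x).
  apply: measurable_funM => //; apply: measurable_funD; first exact: measurable_expR_dotv.
  by apply: measurable_sum => i; apply: measurable_funD; apply: measurable_expR_dotv.
exists (c * fine (\int[m]_x (cross_expR (p.+1%:R * r) t0 (T x) * rho x)%:E)%E) => t tr.
rewrite EFinM fineK; last first.
  by rewrite ge0_fin_numE// integral_ge0// => x _; rewrite lee_fin mulr_ge0.
rewrite -ge0_integralZl//; last 2 first.
- exact/measurable_EFinP.
- by move=> x _; rewrite lee_fin mulr_ge0.
apply: ge0_le_integral => //.
- by move=> x _; rewrite lee_fin exp_moment_ge0.
- by apply/measurable_EFinP; exact: measurable_exp_moment.
- by apply: emeasurable_funM => //; exact/measurable_EFinP.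
- move=> x _; rewrite -EFinM lee_fin mulrA ler_wpM2r//.
  exact: expR_dotv_le_cross.
Qed.

End exp_integral.

(** * Exponential families *)

Lemma measurable_coord {R : realType} {p : nat} d (Y : measurableType d)
    (u : Y -> borel_rV R p) : measurable_fun setT u ->
  forall i, measurable_fun setT (fun x => (u x : 'rV[R]_p) ord0 i).
Proof.
move=> mu i; apply: (@measurableT_comp _ _ _ _ _ _ (fun v : borel_rV R p => (v : 'rV[R]_p) ord0 i)) => //.
apply: (measurability _ (RGenOpens.measurableE R)).
move=> _ [_ [a [b ->] <-]]; rewrite setTI; apply: sub_sigma_algebra.
by apply: open_comp => [v _|]; [exact: coord_continuous|exact: interval_open].
Qed.

Section expfam.
Context {R : realType} {k p : nat}.
Context (T : k.-tuple R -> 'rV[R]_p) (h : k.-tuple R -> R).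
Hypotheses (mT : forall i, measurable_fun setT (fun x => T x ord0 i))
  (mh : measurable_fun setT h) (h_ge0 : forall x, 0 <= h x)
  (A_gtNy : forall t, (-oo < log_normalizer T h t)%E).
Implicit Types (s t : 'rV[R]_p) (x : k.-tuple R) (i : 'I_p).
Local Notation mu := (@lebesgue_tuple R k).
Local Notation A := (log_normalizer T h).
Local Notation q := (expfam T h).
Local Notation a t := (fine (A t)).

(** [A_gtNy] excludes a vanishing integral, for which [lne] is [-oo] and the right side would be
    1. *)
Lemma exp_integralE t : (A t < +oo)%E -> exp_integral mu T h t = (expR (a t))%:E.
Proof.
have := A_gtNy t; rewrite /log_normalizer -/(exp_integral mu T h t).
case: (exp_integral _ _ _ _) => [r||] //=; case: ifPn => // r0 _ _.
by rewrite lnK// posrE ltNge.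
Qed.

Lemma exp_integral_lty t : (exp_integral mu T h t < +oo)%E = (A t < +oo)%E.
Proof.
apply/idP/idP => [|/exp_integralE ->]; last by rewrite ltry.
rewrite /log_normalizer -/(exp_integral mu T h t).
by case: (exp_integral _ _ _ _) => [r||] //= _; case: ifPn => // _; rewrite ?ltry ?ltNyr.
Qed.

Lemma log_normalizer_fineK t : (A t < +oo)%E -> (a t)%:E = A t.
Proof. by move=> At; rewrite fineK// fin_numElt A_gtNy. Qed.

Lemma expfamE t x : (A t < +oo)%E -> q t x = expR (dotv t (T x) - a t) * h x.
Proof. by move=> /log_normalizer_fineK; rewrite /expfam; case: (A t). Qed.

Lemma expfam_ge0 t x : 0 <= q t x.
Proof. by rewrite /expfam; case: (A t) => // r; rewrite mulr_ge0// expR_ge0. Qed.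

Lemma measurable_expfam t : measurable_fun setT (q t).
Proof.
rewrite /expfam; case: (A t) => // r; apply: measurable_funM => //.
apply: measurableT_comp => //; apply: measurable_funB => //.
exact: measurable_dotv.
Qed.

Lemma expfam_scaled t x : (A t < +oo)%E ->
  q t x = expR (- a t) * (expR (dotv t (T x)) * h x).
Proof. by move=> At; rewrite expfamE// expRD mulrA (mulrC (expR _)). Qed.

Lemma integral_expfam t : (A t < +oo)%E -> (\int[mu]_x (q t x)%:E = 1)%E.
Proof.
move=> At; under eq_integral do rewrite expfam_scaled// EFinM.
rewrite ge0_integralZl//.
- by rewrite -/(exp_integral mu T h t) exp_integralE// -EFinM expRN mulVf// expR_eq0.
- apply/measurable_EFinP; apply: measurable_funM => //; exact: measurable_expR_dotv.
- by move=> x _; rewrite lee_fin mulr_ge0// expR_ge0.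
Qed.

Lemma expfam_tilt s t x : (A s < +oo)%E -> (A t < +oo)%E ->
  q s x = expR (dotv (s - t) (T x) - (a s - a t)) * q t x.
Proof.
move=> As At; rewrite !expfamE// mulrA -expRD dotvBl; congr (expR _ * _).
by move: A => B; ring.
Qed.

Lemma integrable_expfam t : (A t < +oo)%E -> mu.-integrable setT (EFin \o q t).
Proof.
move=> At; apply/integrableP; split; first by apply/measurable_EFinP; exact: measurable_expfam.
under eq_integral do rewrite /= ger0_norm ?expfam_ge0//.
by rewrite integral_expfam// ltry.
Qed.

Lemma expfam_locally_bounded t0 : (\forall t \near t0, (A t < +oo)%E) ->
  exists2 r : R, 0 < r & exists B : R, forall t, `|t - t0| <= r ->
  [/\ (A t < +oo)%E, expR (a t) <= B &
   (\int[mu]_x ((1 + dotv (T x) (T x)) * expR (dotv t (T x)) * h x)%:E <= B%:E)%E].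
Proof.
move=> At0.
have {At0} : \forall t \near t0, (exp_integral mu T h t < +oo)%E.
  by near=> t; rewrite exp_integral_lty; near: t.
move=> /(exp_integral_locally_bounded mT mh h_ge0)[r r0 [B HB]].
exists r => //; exists B => t /HB {}HB.
have le1 : (exp_integral mu T h t <= B%:E)%E.
  apply: le_trans HB; apply: ge0_le_integral => //.
  - by move=> x _; rewrite lee_fin mulr_ge0// expR_ge0.
  - apply/measurable_EFinP; apply: measurable_funM => //; exact: measurable_expR_dotv.
  - by apply/measurable_EFinP; exact: measurable_exp_moment.
  - move=> x _; rewrite lee_fin ler_wpM2r// ler_peMl ?expR_ge0// lerDl.
    exact: dotv_ge0.
have At : (A t < +oo)%E by rewrite -exp_integral_lty; exact: le_lt_trans le1 (ltry B).
by split => //; move: le1; rewrite exp_integralE// lee_fin.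
Unshelve. all: by end_near. Qed.

Definition expfam_mean t : 'rV[R]_p := \row_i \int[mu]_x (T x ord0 i * q t x).

Lemma abs_coord_le (y : 'rV[R]_p) i : `|y ord0 i| <= 1 + dotv y y.
Proof.
have : y ord0 i ^+ 2 <= dotv y y.
  rewrite /dotv (bigD1 i)//= -expr2 lerDl; apply: sumr_ge0 => j _.
  by rewrite -expr2 sqr_ge0.
rewrite -(real_normK (num_real (y ord0 i))); have := normr_ge0 (y ord0 i).
by move: `|_| => u; nra.
Qed.

Lemma integral_abs_coord_le t i (B : R) : (A t < +oo)%E ->
  (\int[mu]_x ((1 + dotv (T x) (T x)) * expR (dotv t (T x)) * h x)%:E <= B%:E)%E ->
  (\int[mu]_x `|(T x ord0 i * q t x)%:E| <= (expR (- a t) * B)%:E)%E.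
Proof.
move=> At HB.
apply: (@le_trans _ _ (\int[mu]_x ((expR (- a t))%:E *
    ((1 + dotv (T x) (T x)) * expR (dotv t (T x)) * h x)%:E))%E); last first.
  rewrite ge0_integralZl ?EFinM ?lee_wpmul2l ?lee_fin ?expR_ge0//.
  - by apply/measurable_EFinP; exact: measurable_exp_moment.
  - by move=> x _; rewrite lee_fin exp_moment_ge0.
apply: ge0_le_integral => //.
- apply: measurableT_comp => //; apply/measurable_EFinP; apply: measurable_funM => //.
  exact: measurable_expfam.
- by apply/measurable_EFinP; apply: measurable_funM => //; exact: measurable_exp_moment.
- move=> x _; rewrite /= -EFinM lee_fin normrM (ger0_norm (expfam_ge0 _ _)).
  rewrite expfam_scaled// mulrCA ler_wpM2l ?expR_ge0// -mulrA ler_wpM2r ?abs_coord_le//.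
  by rewrite mulr_ge0// expR_ge0.
Qed.

Lemma integrable_mean t i : (\forall s \near t, (A s < +oo)%E) ->
  mu.-integrable setT (fun x => (T x ord0 i * q t x)%:E).
Proof.
move=> /expfam_locally_bounded[r r0 [B]] /(_ t).
rewrite subrr normr0 => /(_ (ltW r0))[At _ HB].
apply/integrableP; split.
  by apply/measurable_EFinP; apply: measurable_funM => //; exact: measurable_expfam.
exact: le_lt_trans (integral_abs_coord_le i At HB) (ltry _).
Qed.

Lemma integral_dotv_expfam t v : (\forall s \near t, (A s < +oo)%E) ->
  mu.-integrable setT (fun x => (dotv v (T x) * q t x)%:E) /\
  (\int[mu]_x (dotv v (T x) * q t x)%:E = (dotv v (expfam_mean t))%:E)%E.
Proof.
move=> At.
have E x : (dotv v (T x) * q t x)%:E =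
    (\sum_(i < p) (v ord0 i)%:E * (T x ord0 i * q t x)%:E)%E.
  rewrite /dotv mulr_suml -sumEFin; apply: eq_bigr => i _.
  by rewrite -EFinM mulrA.
have intZ i : mu.-integrable setT (fun x => (v ord0 i)%:E * (T x ord0 i * q t x)%:E)%E.
  by apply: integrableZl => //; exact: integrable_mean.
split; first by under eq_fun do rewrite E; exact: integrable_sum.
under eq_integral do rewrite E.
rewrite integral_sum// /dotv -sumEFin; apply: eq_bigr => i _.
rewrite integralZl//; last exact: integrable_mean.
rewrite mxE EFinM fineK//; apply: integrable_fin_num => //; exact: integrable_mean.
Qed.

(* [expR u >= 1 + u] applied to the tilt that takes q t to q s, integrated
   against q t. *)
Lemma log_normalizer_subgradient s t : (\forall t' \near t, (A t' < +oo)%E) ->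
  (A s < +oo)%E -> dotv (s - t) (expfam_mean t) <= a s - a t.
Proof.
move=> nt As; have At := nbhs_singleton nt.
have [id1 id2] := integral_dotv_expfam (s - t) nt.
have iq := integrable_expfam At.
have ic c : mu.-integrable setT (fun x => (c%:E * (q t x)%:E)%E) by exact: integrableZl.
pose c := 1 - (a s - a t).
have : (\int[mu]_x ((c%:E * (q t x)%:E) + (dotv (s - t) (T x) * q t x)%:E)
        <= \int[mu]_x (q s x)%:E)%E.
  apply: le_integral => //.
  - exact: integrableD.
  - exact: integrable_expfam.
  - move=> x _; rewrite -EFinM -EFinD lee_fin (expfam_tilt _ As At) -mulrDl.
    rewrite ler_wpM2r ?expfam_ge0// (le_trans _ (expR_ge1Dx _))// /c.
    by move: A => B; lra.
rewrite integralD// id2 integralZl// !integral_expfam// mule1 -EFinD lee_fin /c.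
by move: A => B; lra.
Qed.

(** The upper companion of [log_normalizer_subgradient]. By [expR_le_taylor1] the integral of
    [expR (c * T_i)] against [q t] exceeds [1 + c * mean] by at most [c ^+ 2] times a remainder. As
    [expR |c * u| <= expR (r * u) + expR (- r * u)], the remainder is bounded by integrals at the
    two parameters [t + r e_i] and [t - r e_i], uniformly in [c]; hence the factor 2 in the
    constant. *)
Lemma log_normalizer_taylor t i : (\forall s \near t, (A s < +oo)%E) ->
  exists2 r : R, 0 < r & exists K : R, forall c, `|c| <= r ->
  (A (t + c *: delta_mx ord0 i) < +oo)%E /\
  a (t + c *: delta_mx ord0 i) - a t <= c * expfam_mean t ord0 i + K * c ^+ 2.
Proof.
move=> nt; have At := nbhs_singleton nt.
have [r r0 [B HB]] := expfam_locally_bounded nt.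
exists r => //; exists (2 * (expR (- a t) * B)) => c cr.
have distE (b : R) : `|b| <= r -> `|t + b *: delta_mx ord0 i - t| <= r.
  move=> br; rewrite addrAC subrr add0r normrZ (le_trans _ br)//.
  by rewrite ler_piMr// norm_deltaE.
have [As _ _] := HB _ (distE _ cr); split => //; set s := t + _ in As *.
have [id1 id2] := integral_dotv_expfam (c *: delta_mx ord0 i) nt.
have iq := integrable_expfam At.
pose F (b : R) x := dotv (T x) (T x) * expR (b * T x ord0 i) * q t x.
have F0 b x : 0 <= F b x by rewrite !mulr_ge0 ?dotv_ge0 ?expR_ge0 ?expfam_ge0.
have mF b : measurable_fun setT (F b).
  apply: measurable_funM; last exact: measurable_expfam.
  apply: measurable_funM; first exact: measurable_dotv.
  by apply: measurableT_comp => //; apply: measurable_funM.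
have HF b : `|b| <= r -> (\int[mu]_x (F b x)%:E <= (expR (- a t) * B)%:E)%E.
  move=> /distE /HB[_ _] le1.
  apply: (@le_trans _ _ (\int[mu]_x ((expR (- a t))%:E *
    ((1 + dotv (T x) (T x)) * expR (dotv (t + b *: delta_mx ord0 i) (T x)) * h x)%:E))%E); last first.
    rewrite ge0_integralZl ?EFinM ?lee_wpmul2l ?lee_fin ?expR_ge0//.
    - by apply/measurable_EFinP; exact: measurable_exp_moment.
    - by move=> x _; rewrite lee_fin exp_moment_ge0.
  apply: ge0_le_integral => //.
  - by move=> x _; rewrite lee_fin.
  - exact/measurable_EFinP.
  - by apply/measurable_EFinP; apply: measurable_funM => //; exact: measurable_exp_moment.
  - move=> x _; rewrite -EFinM lee_fin /F expfam_scaled// dotvDl dotvZl dotv_delta expRD.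
    set e1 := expR (- _); set e2 := expR _; set e3 := expR _.
    have -> : dotv (T x) (T x) * e2 * (e1 * (e3 * h x)) =
       e1 * (dotv (T x) (T x) * (e3 * e2) * h x) by ring.
    rewrite ler_wpM2l ?expR_ge0// ler_wpM2r// ler_wpM2r ?mulr_ge0 ?expR_ge0//.
    by rewrite lerDr.
have iF b : `|b| <= r -> mu.-integrable setT (fun x => (F b x)%:E).
  move=> br; apply/integrableP; split; first exact/measurable_EFinP.
  under eq_integral do rewrite /= ger0_norm//.
  by rewrite (le_lt_trans (HF _ br))// ltry.
have rr : `|r| <= r by rewrite ger0_norm// ltW.
have rNr : `|- r| <= r by rewrite normrN.
have iFF : mu.-integrable setT (fun x => (c ^+ 2)%:E * ((F r x)%:E + (F (- r) x)%:E))%E.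
  by apply: integrableZl => //; apply: integrableD => //; exact: iF.
(* Multiplying by [e] cancels the ratio of normalizations: [e * q s] is [expR (c * T_i) * q t], and
   its integral is [e]. *)
pose e := expR (a s - a t).
have ie : mu.-integrable setT (fun x => e%:E * (q s x)%:E)%E.
  by apply: integrableZl => //; exact: integrable_expfam.
have : (\int[mu]_x (e%:E * (q s x)%:E) <=
    \int[mu]_x (((q t x)%:E + (dotv (c *: delta_mx ord0 i) (T x) * q t x)%:E)
      + (c ^+ 2)%:E * ((F r x)%:E + (F (- r) x)%:E)))%E.
  apply: le_integral => //.
    by apply: integrableD => //; exact: integrableD.
  move=> x _; rewrite -!EFinM -!EFinD lee_fin (expfam_tilt _ As At).
  rewrite /e mulrA -expRD subrKC /s (addrAC t) subrr add0r dotvZl dotv_delta.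
  set u := T x ord0 i.
  have -> : q t x + c * u * q t x + c ^+ 2 * (F r x + F (- r) x) =
     (1 + c * u + c ^+ 2 * (dotv (T x) (T x) * (expR (r * u) + expR (- r * u)))) * q t x.
    by rewrite /F -/u; ring.
  rewrite ler_wpM2r ?expfam_ge0//.
  have := expR_le_taylor1 (c * u); rewrite exprMn.
  suff : c ^+ 2 * u ^+ 2 * expR `|c * u| <=
    c ^+ 2 * (dotv (T x) (T x) * (expR (r * u) + expR (- r * u))) by lra.
  rewrite -mulrA ler_wpM2l ?sqr_ge0// ler_pM ?sqr_ge0 ?expR_ge0//.
    rewrite /dotv (bigD1 i)//= -expr2 lerDl; apply: sumr_ge0 => j _.
    by rewrite -expr2 sqr_ge0.
  rewrite normrM; apply: (@le_trans _ _ (expR (r * `|u|))).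
    by rewrite ler_expR ler_wpM2r.
  have [u0|u0] := leP 0 u; first by rewrite ger0_norm// lerDl expR_ge0.
  by rewrite ltr0_norm// mulNr mulrN lerDr expR_ge0.
rewrite integralZl//; last exact: integrable_expfam.
rewrite integralD//; last exact: integrableD.
rewrite integralD// id2 !integral_expfam// integralZl//; last first.
  by apply: integrableD => //; exact: iF.
rewrite integralD//; [|exact: iF|exact: iF].
rewrite mule1 => le1.
have : (e%:E <= 1 + (dotv (c *: delta_mx ord0 i) (expfam_mean t))%:E +
   (c ^+ 2)%:E * ((expR (- a t) * B)%:E + (expR (- a t) * B)%:E))%E.
  apply: (le_trans le1); rewrite leeD2l// lee_wpmul2l ?lee_fin ?sqr_ge0// leeD//; exact: HF.
rewrite -!EFinD lee_fin dotvZl dotv_delta.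
have := expR_ge1Dx (a s - a t); rewrite /e.
by move: A (expfam_mean t ord0 i) => A0 m0; lra.
Qed.

(** The two inequalities put [a (t + c e_i) - a t - c * mean] between 0 and [K * c ^+ 2], so for [c]
    of either sign the difference quotient is within [K * |c|] of the mean. *)
Lemma gradient_log_normalizer t : (\forall s \near t, (A s < +oo)%E) ->
  grad_log_normalizer T h t = expfam_mean t.
Proof.
move=> nt; apply/rowP => i; rewrite mxE /derive; apply/cvg_lim => //.
have [r r0 [K HK]] := log_normalizer_taylor i nt.
have K1 : 0 < `|K| + 1 by rewrite ltr_wpDl.
apply/cvgrPdist_le => e e0; near=> c.
have c0 : c != 0 by near: c; exact: nbhs_dnbhs_neq.
have cr : `|c| <= r.
  by near: c; apply: dnbhs0_le.
have ce : `|c| <= e / (`|K| + 1).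
  by near: c; apply: dnbhs0_le; rewrite divr_gt0.
have [As le1] := HK _ cr.
have le2 := log_normalizer_subgradient nt As.
rewrite (addrC t) addrK dotvZl dotv_delta in le2.
move: le1 le2; rewrite /= (ord1 0) (addrC t).
move: A => A0.
move: (fine (A0 (c *: delta_mx ord0 i + t))) (fine (A0 t)) (expfam_mean t ord0 i) => a1 a0 m le1 le2.
have -> : m - c^-1 *: (a1 - a0) = - ((a1 - a0 - c * m) / c).
  by rewrite /GRing.scale/=; field.
rewrite normrN normrM normfV ler_pdivrMr ?normr_gt0// ger0_norm ?subr_ge0//.
rewrite (@le_trans _ _ (K * c ^+ 2))//; first lra.
rewrite -(real_normK (num_real c)) expr2 mulrA ler_wpM2r//.
rewrite ler_pdivlMr// in ce.
rewrite (le_trans _ ce)// mulrC ler_wpM2l// (le_trans (ler_norm _))// lerDl//.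
Unshelve. all: by end_near. Qed.

End expfam.

(** * Importance weights *)

(** The rewriting as [u] times a power of [u ^+ 2] reduces to real powers of nonnegative numbers,
    and is right at a zero of [u] as well, where both sides are 0. *)
Lemma measurable_funV {R : realType} d (Y : measurableType d) (u : Y -> R) :
  measurable_fun setT u -> measurable_fun setT (fun x => (u x)^-1).
Proof.
move=> mu.
have -> : (fun x => (u x)^-1) = (fun x => u x * (u x ^+ 2) `^ (-1)).
  apply/funext => x; rewrite powR_inv1 ?sqr_ge0//.
  have [->|u0] := eqVneq (u x) 0; first by rewrite invr0 mul0r.
  by field.
apply: measurable_funM => //.
apply: (@measurableT_comp _ _ _ _ _ _ (@powR R ^~ (-1))).
  exact: measurable_powR.
exact: measurable_funX.
Qed.

Section importance_weights.
Context {R : realType} {k p : nat}.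
Context (T : k.-tuple R -> 'rV[R]_p) (h phi f : k.-tuple R -> R).
Hypotheses (mT : forall i, measurable_fun setT (fun x => T x ord0 i))
  (mh : measurable_fun setT h) (h_ge0 : forall x, 0 <= h x)
  (A_gtNy : forall t, (-oo < log_normalizer T h t)%E)
  (mphi : measurable_fun setT phi) (mf : measurable_fun setT f).
Implicit Types (s t : 'rV[R]_p) (x : k.-tuple R) (i : 'I_p).
Local Notation mu := (@lebesgue_tuple R k).
Local Notation A := (log_normalizer T h).
Local Notation q := (expfam T h).
Local Notation a t := (fine (A t)).
Local Notation K := (weight_fourth_moment T h phi f).
Local Notation grad := (grad_log_normalizer T h).
Local Notation g := (amc_gradient T h phi f).

Let mq t : measurable_fun setT (q t). Proof. exact: measurable_expfam. Qed.
Let q_ge0 t x : 0 <= q t x. Proof. exact: expfam_ge0. Qed.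

Definition weight2 t x : R := phi x ^+ 2 * f x ^+ 2 / q t x.
Definition weight4 t x : R := phi x ^+ 4 * f x ^+ 4 / q t x ^+ 3.
Definition second_moment t : \bar R := (\int[mu]_x (weight2 t x)%:E)%E.
Definition sq_gradient t : \bar R := (\int[mu]_x (enorm (g t x) ^+ 2 * q t x)%:E)%E.

Lemma weight2_ge0 t x : 0 <= weight2 t x.
Proof. by rewrite divr_ge0// mulr_ge0// sqr_ge0. Qed.

Lemma weight4_ge0 t x : 0 <= weight4 t x.
Proof. by rewrite divr_ge0 ?exprn_ge0// mulr_ge0// exprn_even_ge0. Qed.

Lemma measurable_weight2 t : measurable_fun setT (weight2 t).
Proof.
apply: measurable_funM; last exact: measurable_funV.
by apply: measurable_funM; exact: measurable_funX.
Qed.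

Lemma measurable_weight4 t : measurable_fun setT (weight4 t).
Proof.
apply: measurable_funM; last by apply: measurable_funV; exact: measurable_funX.
by apply: measurable_funM; exact: measurable_funX.
Qed.

Lemma fourth_moment_lty t : (K t < +oo)%E ->
  (A t < +oo)%E /\ (\int[mu]_x (weight4 t x)%:E < +oo)%E.
Proof. by rewrite /weight_fourth_moment; case: ifPn => // At Koo; split; rewrite // ltey. Qed.

(** [weight4] is [weight2 ^+ 2 / q], so multiplication by [q] turns the claim into
    [w * q <= w ^+ 2 + q ^+ 2]. Since [q] has mass 1, a finite fourth moment thus forces a finite
    second moment. *)
Lemma weight2_le t x : weight2 t x <= weight4 t x + q t x.
Proof.
rewrite /weight2 /weight4; have [->|q0] := eqVneq (q t x) 0.
  by rewrite expr0n/= invr0 !mulr0 addr0.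
have qp : 0 < q t x by rewrite lt_neqAle eq_sym q0/=.
have -> : phi x ^+ 4 * f x ^+ 4 / q t x ^+ 3 =
  (phi x ^+ 2 * f x ^+ 2 / q t x) ^+ 2 / q t x by field.
move: (_ / q t x) => s.
rewrite -(ler_pM2r qp) mulrDl divfK//; nra.
Qed.

Lemma second_moment_lty t : (K t < +oo)%E -> (second_moment t < +oo)%E.
Proof.
move=> /fourth_moment_lty[At Kt].
apply: (@le_lt_trans _ _ (\int[mu]_x ((weight4 t x)%:E + (q t x)%:E))%E).
  apply: ge0_le_integral => //.
  - by move=> x _; rewrite lee_fin weight2_ge0.
  - by apply/measurable_EFinP; exact: measurable_weight2.
  - apply: emeasurable_funD; first by apply/measurable_EFinP; exact: measurable_weight4.
    exact/measurable_EFinP.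
  - by move=> x _; rewrite -EFinD lee_fin weight2_le.
rewrite ge0_integralD//.
- by rewrite integral_expfam// lte_add_pinfty// ltry.
- by move=> x _; rewrite lee_fin weight4_ge0.
- by apply/measurable_EFinP; exact: measurable_weight4.
- by move=> x _; rewrite lee_fin.
- exact/measurable_EFinP.
Qed.

Lemma weight_varianceE t : (K t < +oo)%E ->
  weight_variance T h phi f t = (second_moment t - (target phi f ^+ 2)%:E)%E.
Proof. by move=> /fourth_moment_lty[At _]; rewrite /weight_variance lt_eqF. Qed.

Lemma sq_gradientE t x : enorm (g t x) ^+ 2 * q t x =
  weight4 t x * dotv (grad t - T x) (grad t - T x).
Proof.
rewrite sqr_enorm /amc_gradient dotvZl dotvZr /weight4.
have [->|q0] := eqVneq (q t x) 0; first by rewrite !expr0n/= invr0 !(mulr0,mul0r).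
by field.
Qed.

(** This exhibits the fourth moment as an exponential integral with statistic [- 3 T], so that
    [exp_integral_locally_bounded] applies to it. *)
Lemma weight4_scaled t x : (A t < +oo)%E -> weight4 t x =
  expR (3 * a t) * (expR (dotv t (- 3 *: T x)) * (phi x ^+ 4 * f x ^+ 4 / h x ^+ 3)).
Proof.
move=> At; rewrite /weight4 expfam_scaled// dotvZr.
rewrite -!exprVn !invfM !exprMn -!expRN -!expRM_natl opprK !mulrN mulNr.
by move: A => A0; ring.
Qed.

Lemma measurable_sq_gradient t :
  measurable_fun setT (fun x => weight4 t x * dotv (grad t - T x) (grad t - T x)).
Proof.
apply: measurable_funM; first exact: measurable_weight4.
by apply: measurable_dotv => i; under eq_fun do rewrite !mxE; exact: measurable_funB.
Qed.

Lemma near_log_normalizer t0 : (\forall t \near t0, (K t < +oo)%E) ->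
  \forall t \near t0, \forall s \near t, (A s < +oo)%E.
Proof.
move=> /nbhs_interior; apply: filterS => t; apply: filterS => s.
by move=> /fourth_moment_lty[].
Qed.

(* With a := A t, the second moment of the gradient is at most
   e^(3a) (|grad|^2 + 1) times an exponential integral; the factor e^(3a)
   absorbs the normalization of |grad|, so that no lower bound on a is needed. *)
Lemma sq_gradient_locally_bounded t0 : (\forall t \near t0, (K t < +oo)%E) ->
  exists B : R, \forall t \near t0, (sq_gradient t <= B%:E)%E.
Proof.
move=> nK; have nnA := near_log_normalizer nK.
pose T3 x : 'rV[R]_p := - 3 *: T x.
pose rho x : R := phi x ^+ 4 * f x ^+ 4 / h x ^+ 3.
have mT3 i : measurable_fun setT (fun x => T3 x ord0 i).
  by rewrite /T3; under eq_fun do rewrite mxE; exact: measurable_funM.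
have mrho : measurable_fun setT rho.
  apply: measurable_funM; last by apply: measurable_funV; exact: measurable_funX.
  by apply: measurable_funM; exact: measurable_funX.
have rho0 x : 0 <= rho x.
  by rewrite divr_ge0 ?exprn_ge0// mulr_ge0// exprn_even_ge0.
have nrho : \forall t \near t0, (exp_integral mu T3 rho t < +oo)%E.
  move: nK; apply: filterS => t /fourth_moment_lty[At].
  have e3 := expR_gt0 (3 * a t).
  under eq_integral do rewrite weight4_scaled// EFinM.
  have mE : measurable_fun setT (fun x => (expR (dotv t (T3 x)) * rho x)%:E).
    by apply/measurable_EFinP; apply: measurable_funM => //; exact: measurable_expR_dotv.
  rewrite ge0_integralZl ?lee_fin ?(ltW e3)//; last first.
    by move=> x _; rewrite lee_fin; exact: mulr_ge0 (expR_ge0 _) (rho0 _).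
  rewrite /exp_integral; case: (integral _ _ _) => [r||]//; rewrite ?ltry//.
  by rewrite gt0_muley ?lte_fin.
have [r1 r10 [B1 HB1]] := expfam_locally_bounded mT mh h_ge0 A_gtNy
  (nbhs_singleton nnA).
have [r2 r20 [B2 HB2]] := exp_integral_locally_bounded mT3 mrho rho0 nrho.
have near_le (r : R) : 0 < r -> \forall t \near t0, `|t - t0| <= r.
  move=> r0; apply/nbhs_ballP; exists r => //= t.
  by rewrite -ball_normE/= distrC => /ltW.
exists (2 * (p.+1%:R * B1 ^+ 3) * B2); near=> t.
have nA : \forall s \near t, (A s < +oo)%E by near: t.
have [|At aB1 TB1] := HB1 t; first by near: t; exact: near_le.
have {HB2}/HB2 JB : `|t - t0| <= r2 by near: t; exact: near_le.
have B10 : 0 <= B1 by rewrite (le_trans _ aB1)// expR_ge0.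
have gradE := gradient_log_normalizer mT mh h_ge0 A_gtNy nA.
(* The factor [expR (a t)] undoes the normalization in the mean of [T_i], leaving an integral that
   [B1] dominates. *)
have gB i : expR (a t) * `|grad t ord0 i| <= B1.
  rewrite gradE mxE -ler_pdivlMl ?expR_gt0// -expRN -lee_fin.
  have im := integrable_mean mT mh h_ge0 A_gtNy i nA.
  apply: le_trans (integral_abs_coord_le mT mh h_ge0 A_gtNy i At TB1).
  apply: le_trans (le_abse_integral mu measurableT (measurable_int _ im)).
  by rewrite -(fineK (integrable_fin_num measurableT im)).
(* Of the three factors [expR (a t)], two go to the square of [grad_i] and one remains; every factor
   is then at most [B1]. The count [p + 1] is one term per coordinate and one for the constant 1. *)
have cB : expR (3 * a t) * (1 + dotv (grad t) (grad t)) <= p.+1%:R * B1 ^+ 3.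
  have -> : expR (3 * a t) = expR (a t) ^+ 3 by rewrite -expRM_natl.
  have e0 := expR_gt0 (a t); set e := expR (a t) in aB1 gB e0 *.
  have -> : e ^+ 3 * (1 + dotv (grad t) (grad t)) =
      e ^+ 3 + \sum_(i < p) e * (e * grad t ord0 i) ^+ 2.
    rewrite mulrDr mulr1 /dotv mulr_sumr; congr (_ + _); apply: eq_bigr => i _; ring.
  have -> : p.+1%:R * B1 ^+ 3 = B1 ^+ 3 + \sum_(i < p) B1 ^+ 3.
    by rewrite sumr_const card_ord -natr1 mulrDl mul1r mulr_natl addrC.
  rewrite lerD ?lerXn2r ?nnegrE ?(ltW e0)//; apply: ler_sum => i _.
  rewrite [leRHS]exprS ler_pM ?(ltW e0) ?sqr_ge0// -(real_normK (num_real (_ * _))).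
  rewrite lerXn2r ?nnegrE//= normrM (ger0_norm (ltW e0)); exact: gB.
rewrite /sq_gradient; under eq_integral do rewrite sq_gradientE.
pose c := 2 * (p.+1%:R * B1 ^+ 3).
have c0 : 0 <= c by rewrite !mulr_ge0// exprn_ge0.
pose J x := (1 + dotv (T3 x) (T3 x)) * expR (dotv t (T3 x)) * rho x.
have J0 x : 0 <= J x by exact: exp_moment_ge0.
have mJ : measurable_fun setT J by exact: measurable_exp_moment.
apply: (@le_trans _ _ (\int[mu]_x (c%:E * (J x)%:E))%E); last first.
  rewrite ge0_integralZl ?EFinM ?lee_wpmul2l ?lee_fin//.
  - exact/measurable_EFinP.
  - by move=> x _; rewrite lee_fin.
apply: ge0_le_integral => //.
- by move=> x _; rewrite lee_fin mulr_ge0 ?weight4_ge0 ?dotv_ge0.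
- by apply/measurable_EFinP; exact: measurable_sq_gradient.
- by apply/measurable_EFinP; exact: measurable_funM.
- move=> x _; rewrite -EFinM lee_fin /J weight4_scaled// -/(T3 x) -/(rho x).
  have h1 : dotv (grad t - T x) (grad t - T x) <=
      2 * ((1 + dotv (grad t) (grad t)) * (1 + dotv (T3 x) (T3 x))).
    (* Nonnegativity of [|grad + T|^2] gives [|grad - T|^2 <= 2 |grad|^2 + 2 |T|^2], and [|T3|^2] is
       [9 |T|^2]. *)
    have := dotv_ge0 (grad t + T x); have := dotv_ge0 (T x); have := dotv_ge0 (grad t).
    rewrite /T3 !(dotvZl, dotvZr, dotvBl, dotvBr, dotvDl, dotvDr) (dotvC (T x)).
    move: (dotv _ _) (dotv (T x) _) (dotv (grad t) (T x)) => u v w; nra.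
  have h2 : 0 <= expR (dotv t (T3 x)) * rho x by rewrite mulr_ge0// expR_ge0.
  have h3 : 0 <= 1 + dotv (T3 x) (T3 x) by rewrite addr_ge0// dotv_ge0.
  apply: (le_trans (ler_wpM2l (mulr_ge0 (expR_ge0 _) h2) h1)).
  have h4 := ler_wpM2r (mulr_ge0 h3 h2) cB.
  rewrite /c; move: h4; set e1 := expR _; set e2 := expR _.
  by move: (dotv (T3 x) _) (dotv (grad t) _) => u v; lra.
Unshelve. all: by end_near. Qed.

(* [expR u >= 1 + u] for the log-ratio of the two densities; the subgradient
   inequality for the log-normalizer makes the lower bound linear in [s]. *)
Lemma weight2_convex s t x : (\forall t' \near t, (A t' < +oo)%E) ->
  (A s < +oo)%E ->
  weight2 t x * (1 + dotv (grad t - T x) (s - t)) <= weight2 s x.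
Proof.
move=> nt As; have At := nbhs_singleton nt.
have le1 := log_normalizer_subgradient mT mh h_ge0 A_gtNy nt As.
rewrite -gradient_log_normalizer// dotvC in le1.
have -> : weight2 s x =
    weight2 t x * expR (- (dotv (s - t) (T x) - (a s - a t))).
  rewrite /weight2 (expfam_tilt A_gtNy _ As At)// invfM -expRN.
  by rewrite [expR _ * _]mulrC mulrA.
rewrite ler_wpM2l ?weight2_ge0//.
apply: le_trans (expR_ge1Dx _); rewrite dotvBl (dotvC (T x)).
by move: le1; move: (dotv _ _) (dotv _ _) => u v; move: A => A0; lra.
Qed.

(** As in [weight2_le], now with [u = grad - T]: since [weight4 * |u|^2] is [(weight2 * |u|)^2 / q],
    the product [weight2 * |u|] is at most [weight4 * |u|^2 + q]. The two summands account for [B]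
    and for 1. *)
Lemma second_moment_lipschitz s t (B : R) : (\forall t' \near t, (A t' < +oo)%E) ->
  (A s < +oo)%E -> (sq_gradient t <= B%:E)%E ->
  (second_moment t <= second_moment s + (p%:R * `|s - t| * (B + 1))%:E)%E.
Proof.
move=> nt As HB; have At := nbhs_singleton nt.
pose c : R := p%:R * `|s - t|.
have c0 : 0 <= c by rewrite mulr_ge0.
pose F x := weight4 t x * dotv (grad t - T x) (grad t - T x).
have F0 x : 0 <= F x by rewrite mulr_ge0 ?weight4_ge0 ?dotv_ge0.
have mF : measurable_fun setT F by exact: measurable_sq_gradient.
have FB : (\int[mu]_x (F x)%:E <= B%:E)%E.
  by move: HB; rewrite /sq_gradient; under eq_integral do rewrite sq_gradientE.
apply: (@le_trans _ _ (\int[mu]_x ((weight2 s x)%:E + c%:E * ((F x)%:E + (q t x)%:E)))%E).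
  apply: ge0_le_integral => //.
  - by move=> x _; rewrite lee_fin weight2_ge0.
  - by apply/measurable_EFinP; exact: measurable_weight2.
  - apply: emeasurable_funD; first by apply/measurable_EFinP; exact: measurable_weight2.
    by apply: emeasurable_funM => //; apply: emeasurable_funD; exact/measurable_EFinP.
  - move=> x _; rewrite -!EFinD lee_fin.
    have le1 := weight2_convex x nt As.
    suff : weight2 t x * `|dotv (grad t - T x) (s - t)| <= c * (F x + q t x).
      have := weight2_ge0 t x; move: (dotv _ _) le1 => u le1 w0.
      have : weight2 t x * - u <= weight2 t x * `|u|.
        by rewrite ler_wpM2l// -normrN ler_norm.
      lra.
    set u := grad t - T x.
    apply: (@le_trans _ _ (weight2 t x * (c * `|u|))).
      rewrite ler_wpM2l ?weight2_ge0// (le_trans (norm_dotv_le _ _))// /c.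
      by rewrite mulrAC.
    rewrite mulrCA ler_wpM2l//.
    have u2 := norm_le_dotv u.
    apply: (@le_trans _ _ (weight4 t x * `|u| ^+ 2 + q t x)); last first.
      by rewrite lerD2r ler_wpM2l ?weight4_ge0.
    rewrite /weight2 /weight4; have [->|q0] := eqVneq (q t x) 0.
      by rewrite expr0n/= invr0 !mulr0 !mul0r addr0.
    have qp : 0 < q t x by rewrite lt_neqAle eq_sym q0/=.
    have -> : phi x ^+ 4 * f x ^+ 4 / q t x ^+ 3 * `|u| ^+ 2 =
      (phi x ^+ 2 * f x ^+ 2 / q t x * `|u|) ^+ 2 / q t x by field.
    move: (_ / q t x * `|u|) => v.
    rewrite -(ler_pM2r qp) mulrDl divfK//; nra.
rewrite ge0_integralD//; last 4 first.
- by move=> x _; rewrite lee_fin weight2_ge0.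
- by apply/measurable_EFinP; exact: measurable_weight2.
- by move=> x _; rewrite mule_ge0// ?adde_ge0// lee_fin.
- by apply: emeasurable_funM => //; apply: emeasurable_funD; exact/measurable_EFinP.
rewrite leeD2l// [leRHS]EFinM -/c ge0_integralZl//; last 2 first.
- by apply: emeasurable_funD; exact/measurable_EFinP.
- by move=> x _; rewrite adde_ge0// lee_fin.
rewrite lee_wpmul2l ?lee_fin// ge0_integralD//; last 4 first.
- by move=> x _; rewrite lee_fin.
- exact/measurable_EFinP.
- by move=> x _; rewrite lee_fin.
- exact/measurable_EFinP.
by rewrite integral_expfam// EFinD leeD2r.
Qed.

End importance_weights.

(** * Compact convex parameter sets *)

Section parameter_set.
Context {R : realType} {p : nat}.
Implicit Types (u v t y z : 'rV[R]_p).
Variable Theta : set 'rV[R]_p.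

Lemma dotv_sqrB u v : dotv (u - v) (u - v) = dotv u u - 2 * dotv u v + dotv v v.
Proof. by rewrite !(dotvBl, dotvBr) (dotvC v u); ring. Qed.

Lemma enorm_continuous : continuous (@enorm R p).
Proof.
move=> u; apply: (@continuous_comp _ _ _ (fun v => dotv v v) (@Num.sqrt R)).
  move: u; apply: continuous_big => [|i _ w]; first exact: add_continuous.
  have ci := @coord_continuous R 1 p ord0 i w.
  exact: (cvgM ci ci).
exact: sqrt_continuous.
Qed.

(** [diameter] is a real [sup], meaningful only for a set bounded above; a maximizing pair supplies
    both the bound and the attained value. *)
Lemma compact_farthest_pair : compact Theta -> Theta !=set0 ->
  exists t1 t2, [/\ Theta t1, Theta t2 &
    forall u v, Theta u -> Theta v -> enorm (u - v) <= enorm (t1 - t2)].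
Proof.
move=> cT [t0 Tt0].
have [] := @compact_EVT_max _ R
  (fun t : 'rV[R]_p * 'rV[R]_p => enorm (t.1 - t.2)) (Theta `*` Theta).
- by exists (t0, t0).
- exact: compact_setX.
- apply: continuous_subspaceT => t.
  apply: (@continuous_comp _ _ _
    (fun t : 'rV[R]_p * 'rV[R]_p => t.1 - t.2) (@enorm R p)).
    by apply: cvgB; [exact: cvg_fst|exact: cvg_snd].
  exact: enorm_continuous.
move=> [t1 t2]; rewrite inE => -[/= Tt1 Tt2] tmax.
exists t1, t2; split => // u v Tu Tv.
by have := tmax (u, v); rewrite inE; exact.
Qed.

Lemma diameter_attained : compact Theta -> Theta !=set0 ->
  exists t1 t2, [/\ Theta t1, Theta t2 & enorm (t1 - t2) = diameter Theta].
Proof.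
move=> cT T0; have [t1 [t2 [Tt1 Tt2 tmax]]] := compact_farthest_pair cT T0.
exists t1, t2; split => //; apply/esym/eqP; rewrite eq_le; apply/andP; split.
  apply: ge_sup; first by exists (enorm (t1 - t2)); exists (t1, t2).
  by move=> _ [t [Tu Tv] <-]; exact: tmax.
apply: ub_le_sup; last by exists (t1, t2).
by exists (enorm (t1 - t2)) => _ [t [Tu Tv] <-]; exact: tmax.
Qed.

Lemma enorm_le_diameter : compact Theta -> forall t1 t2, Theta t1 -> Theta t2 ->
  enorm (t1 - t2) <= diameter Theta.
Proof.
move=> cT t1 t2 Tt1 Tt2.
have [u1 [u2 [_ _ umax]]] := compact_farthest_pair cT (ex_intro _ _ Tt1).
apply: ub_le_sup; last by exists (t1, t2).
by exists (enorm (u1 - u2)) => _ [t [Tu Tv] <-]; exact: umax.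
Qed.

(* Moving from the projection z' of y a little towards z does not decrease the
   distance to y, which makes the angle at z' between y and z obtuse. *)
Lemma projection_contracts y z z' : convex_set Theta -> Theta z ->
  is_projection Theta y z' -> enorm (z' - z) ^+ 2 <= enorm (y - z) ^+ 2.
Proof.
move=> cT Tz [Tz' zmin].
pose u := y - z'; pose v := z - z'.
have uv : dotv u v <= 0.
  rewrite leNgt; apply/negP => uv0.
  have step (s : R) : 0 < s -> s < 1 -> 2 * dotv u v <= s * dotv v v.
    move=> s0 s1.
    have : Theta (s *: z + (1 - s) *: z').
      have s01 : 0 <= s <= 1 by rewrite !ltW.
      have := (convex_setW Theta).1 cT z z' (mem_set Tz) (mem_set Tz')
        (Itv01 (ltW s0) (ltW s1)) s0 s1.
      by rewrite inE.
    move=> /zmin; rewrite -ler_sqr ?nnegrE ?enorm_ge0// !sqr_enorm.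
    have -> : y - (s *: z + (1 - s) *: z') = u - s *: v.
      by apply/rowP => i; rewrite !mxE; ring.
    rewrite -/u [dotv (u - _) _]dotv_sqrB dotvZl !dotvZr.
    move: (dotv u u) (dotv u v) (dotv v v) => a b c h.
    by rewrite -(ler_pM2l s0); lra.
  have vv := dotv_ge0 v.
  (* The entry [1 / 2] keeps [s < 1]. The other one gives [s * (|v|^2 + 1) <= <u, v>], which
     contradicts [2 <u, v> <= s * |v|^2]; the added 1 avoids a zero denominator. *)
  pose s := Num.min (1 / 2) (dotv u v / (dotv v v + 1)).
  have s0 : 0 < s by rewrite lt_min divr_gt0//= divr_gt0// ltr_wpDl.
  have s1 : s < 1 by rewrite gt_min; apply/orP; left; lra.
  have := step s s0 s1.
  have : s * (dotv v v + 1) <= dotv u v.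
    by rewrite -ler_pdivlMr ?ltr_wpDl// ge_min lexx orbT.
  by move: uv0 s0; move: (dotv u v) (dotv v v) (s) => a b c; lra.
rewrite !sqr_enorm.
have -> : z' - z = - v by rewrite opprB.
have -> : y - z = u - v by rewrite /u /v opprB addrA subrK.
rewrite [dotv (u - _) _]dotv_sqrB dotvNl dotvC dotvNl opprK.
have := dotv_ge0 u; lra.
Qed.

End parameter_set.

Section compact_parameters.
Context {R : realType} {k p : nat}.
Context (T : k.-tuple R -> 'rV[R]_p) (h phi f : k.-tuple R -> R).
Context (Theta : set 'rV[R]_p).
Hypotheses (mT : forall i, measurable_fun setT (fun x => T x ord0 i))
  (mh : measurable_fun setT h) (h_ge0 : forall x, 0 <= h x)
  (A_gtNy : forall t, (-oo < log_normalizer T h t)%E)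
  (mphi : measurable_fun setT phi) (mf : measurable_fun setT f).
Hypotheses (Theta_sub : Theta `<=`
       interior [set t | (weight_fourth_moment T h phi f t < +oo)%E])
    (Theta_neq0 : Theta !=set0) (Theta_compact : compact Theta).
Local Notation W := (second_moment T h phi f).
Local Notation G := (sq_gradient T h phi f).

(** Compactness in near-covering form, with the bound itself as the parameter tending to [+oo]: near
    each point every large bound works, so some bound works on all of [Theta]. *)
Lemma sq_gradient_bounded : exists B : R, forall t, Theta t -> (G t <= B%:E)%E.
Proof.
have := (compact_near_coveringP Theta).1 Theta_compact R (pinfty_nbhs R)
  (fun B t => (G t <= B%:E)%E) _.
case.
  move=> t0 /Theta_sub nK.
  have [B HB] := sq_gradient_locally_bounded mT mh h_ge0 A_gtNy mphi mf nK.
  near=> t B' => /=; rewrite (@le_trans _ _ B%:E)//.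
    by near: t.
  by rewrite lee_fin; near: B'; apply: nbhs_pinfty_ge; exact: num_real.
(* A neighbourhood of [+oo] only speaks of values strictly above [B]. *)
move=> B [_ HB]; exists (B + 1) => t Tt; apply: HB => //; rewrite ltrDl//.
Unshelve. all: by end_near. Qed.

Lemma Theta_near_log_normalizer t : Theta t ->
  \forall s \near t, (log_normalizer T h s < +oo)%E.
Proof. by move=> /Theta_sub /near_log_normalizer /nbhs_singleton. Qed.

Lemma Theta_fourth_moment_lty t : Theta t ->
  (weight_fourth_moment T h phi f t < +oo)%E.
Proof. by move=> /Theta_sub /nbhs_singleton. Qed.

Lemma Theta_second_moment_fin t : Theta t -> W t \is a fin_num.
Proof.
move=> Tt; rewrite ge0_fin_numE ?integral_ge0//.
  exact: (second_moment_lty mT mh h_ge0 A_gtNy mphi mf (Theta_fourth_moment_lty Tt)).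
by move=> x _; rewrite lee_fin weight2_ge0.
Qed.

Lemma second_moment_min :
  exists2 t0, Theta t0 & forall t, Theta t -> (W t0 <= W t)%E.
Proof.
have [B HB] := sq_gradient_bounded.
have lip s t : Theta s -> Theta t ->
    fine (W t) - fine (W s) <= p%:R * `|s - t| * (B + 1).
  move=> Ts Tt.
  have := second_moment_lipschitz mT mh h_ge0 A_gtNy mphi mf
     (Theta_near_log_normalizer Tt) (nbhs_singleton (Theta_near_log_normalizer Ts)) (HB _ Tt).
  rewrite -(fineK (Theta_second_moment_fin Ts)) -(fineK (Theta_second_moment_fin Tt)).
  by rewrite -EFinD lee_fin lerBlDl.
have [] := @compact_EVT_min _ R (fun t => fine (W t)) Theta => //.
  apply/subspace_continuousP => t0 Tt0.
  apply/cvgrPdist_le => e e0.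
  pose c : R := `|p%:R * (B + 1)| + 1.
  have c0 : 0 < c by rewrite ltr_wpDl.
  rewrite near_withinE; near=> t => Tt.
  have te : `|t - t0| <= e / c.
    near: t; apply/nbhs_ballP; exists (e / c); first by rewrite /= divr_gt0.
    by move=> t; rewrite -ball_normE/= distrC => /ltW.
  have tec : p%:R * `|t - t0| * (B + 1) <= e.
    rewrite mulrAC (le_trans (ler_wpM2r _ (ler_norm _)))//.
    rewrite (@le_trans _ _ (c * `|t - t0|)) ?ler_wpM2r ?lerDl//.
    by rewrite mulrC -ler_pdivlMr.
  rewrite ler_norml lerNl opprB; apply/andP; split.
    by apply: le_trans tec; rewrite (distrC t); exact: lip.
  by apply: le_trans tec; exact: lip.
move=> t0 /set_mem Tt0 tmin; exists t0; first exact: Tt0.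
move=> t Tt; have := tmin t (mem_set Tt).
move: (Theta_second_moment_fin Tt0) (Theta_second_moment_fin Tt).
by move: W => W0 fin0 fin1; rewrite -lee_fin !fineK.
Unshelve. all: by end_near. Qed.

End compact_parameters.

(** * Joint measurability *)

Section joint_measurability.
Context {R : realType} {k p : nat} d (S : measurableType d).
Context (T : k.-tuple R -> 'rV[R]_p) (h phi f : k.-tuple R -> R).
Hypotheses (mT : forall i, measurable_fun setT (fun x => T x ord0 i))
  (mh : measurable_fun setT h) (h_ge0 : forall x, 0 <= h x)
  (A_gtNy : forall t, (-oo < log_normalizer T h t)%E)
  (mphi : measurable_fun setT phi) (mf : measurable_fun setT f).
Local Notation mu := (@lebesgue_tuple R k).
Local Notation A := (log_normalizer T h).
Local Notation q := (expfam T h).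

(* The junk value fine (+oo) = 0 makes this hold also when the integral is
   infinite. *)
Lemma expfam_exp_integral t x :
  q t x = expR (dotv t (T x)) * h x / fine (exp_integral mu T h t).
Proof.
have [At|At] := boolP (A t < +oo)%E.
  by rewrite (exp_integralE A_gtNy At)/= (expfam_scaled A_gtNy _ At) expRN mulrC.
have := At; rewrite -(exp_integral_lty A_gtNy) ltey negbK => /eqP ->.
by rewrite /= invr0 mulr0 /expfam; move: At; rewrite ltey negbK => /eqP ->.
Qed.

Variable u : S -> 'rV[R]_p.
Hypothesis mu_coord : forall i, measurable_fun setT (fun s => u s ord0 i).

Let mE : measurable_fun setT (fun z : S * k.-tuple R => expR (dotv (u z.1) (T z.2)) * h z.2).
Proof.
apply: measurable_funM; last exact: measurableT_comp.
apply: measurable_expR_dotv => i.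
  exact: (measurableT_comp (mu_coord i) measurable_fst).
exact: (measurableT_comp (mT i) measurable_snd).
Qed.

Lemma measurable_expfam_joint :
  measurable_fun setT (fun z : S * k.-tuple R => q (u z.1) z.2).
Proof.
under eq_fun do rewrite expfam_exp_integral.
apply: measurable_funM => //; apply: measurable_funV.
apply: (@measurableT_comp _ _ _ _ _ _ (fun s => fine (exp_integral mu T h (u s)))) => //.
apply: (@measurableT_comp _ _ _ _ _ _ fine) => //.
have := @measurable_fun_fubini_tonelli_F _ _ S _ R mu
  (fun z : S * k.-tuple R => (expR (dotv (u z.1) (T z.2)) * h z.2)%:E).
by apply => //; [exact/measurable_EFinP|
  move=> z; rewrite lee_fin mulr_ge0// expR_ge0].
Qed.

Lemma measurable_expfam_comp (v : S -> k.-tuple R) : measurable_fun setT v ->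
  measurable_fun setT (fun s => q (u s) (v s)).
Proof.
move=> mv; apply: (measurableT_comp measurable_expfam_joint (g := fun s => (s, v s))).
exact: measurable_fun_pair.
Qed.

(** Serves to show that the gradient of the log-normalizer is measurable in the parameter, which its
    definition by limits hides. Splitting into positive and negative parts makes Tonelli enough. *)
Lemma measurable_expfam_mean i :
  measurable_fun setT (fun s => expfam_mean T h (u s) ord0 i).
Proof.
under eq_fun do rewrite mxE.
apply: (@measurableT_comp _ _ _ _ _ _ fine) => //.
pose F (z : S * k.-tuple R) := (T z.2 ord0 i * q (u z.1) z.2)%:E.
have mF : measurable_fun setT F.
  apply/measurable_EFinP; apply: measurable_funM; last exact: measurable_expfam_joint.
  exact: (measurableT_comp (mT i) measurable_snd).
have -> : (fun s => \int[mu]_x (T x ord0 i * q (u s) x)%:E)%E =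
  (fun s => \int[mu]_x F^\+ (s, x) - \int[mu]_x F^\- (s, x))%E.
  apply/funext => s; rewrite integralE.
  by congr (_ - _)%E; apply: eq_integral => x _; rewrite ?funeposE ?funenegE.
have mpos : measurable_fun setT (fun s => \int[mu]_x (F^\+)%E (s, x))%E.
  have := @measurable_fun_fubini_tonelli_F _ _ S _ R mu (F^\+)%E.
  by apply => //; exact: measurable_funepos.
have mneg : measurable_fun setT (fun s => \int[mu]_x F^\- (s, x))%E.
  have := @measurable_fun_fubini_tonelli_F _ _ S _ R mu (F^\-)%E.
  by apply => //; exact: measurable_funeneg.
exact: emeasurable_funB mpos mneg.
Qed.

Hypothesis near_u : forall s, \forall t \near u s, (A t < +oo)%E.

Lemma measurable_amc_gradient_joint i :
  measurable_fun setT (fun z : S * k.-tuple R =>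
    amc_gradient T h phi f (u z.1) z.2 ord0 i).
Proof.
under eq_fun do rewrite /amc_gradient
  (gradient_log_normalizer mT mh h_ge0 A_gtNy (near_u _)) mxE
  [X in _ * X]mxE [X in _ * (_ + X)]mxE.
have mc (g : k.-tuple R -> R) : measurable_fun setT g ->
    measurable_fun setT (fun z : S * k.-tuple R => g z.2).
  by move=> mg; exact: (measurableT_comp mg measurable_snd).
apply: measurable_funM.
  apply: measurable_funM.
    by apply: measurable_funM; apply: measurable_funX; exact: mc.
  by apply: measurable_funV; apply: measurable_funX; exact: measurable_expfam_joint.
apply: measurable_funB; last exact: (mc (fun x => T x ord0 i)).
exact: (measurableT_comp (measurable_expfam_mean i) measurable_fst).
Qed.

End joint_measurability.

(** * The convex adaptive Monte Carlo algorithm *)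

Lemma sqr_integrable_Lfun2 d (Y : measurableType d) (R : realType)
    (m : {measure set Y -> \bar R}) (g : Y -> R) : measurable_fun setT g ->
  (\int[m]_x (g x ^+ 2)%:E < +oo)%E -> g \in Lfun m 2%:E.
Proof.
move=> mg goo; rewrite inE; apply/andP; split; rewrite inE//=.
rewrite /finite_norm unlock poweR_lty//.
by under eq_integral do rewrite /= powR_mulrn// real_normK ?num_real//.
Qed.

Lemma integral_probability_cst d (Y : measurableType d) (R : realType)
    (P : probability Y R) (c : \bar R) : (\int[P]_x cst c x = c)%E.
Proof. by rewrite integral_cst//= probability_setT mule1. Qed.

(* Abel summation: the weights sqrt i / (2 C) increase with i, so the telescoping
   differences cost at most the last weight times the bound on [D]. *)
Lemma descent_sum {R : realType} (C B M w0 : R) (D e : nat -> R) :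
  0 < C -> 0 <= B -> (forall n, (1 <= n)%N -> D n <= M) ->
  (forall n, (1 <= n)%N -> D n.+1 + 2 * (C / Num.sqrt n%:R) * e n <=
    D n + 2 * (C / Num.sqrt n%:R) * w0 + (C / Num.sqrt n%:R) ^+ 2 * B) ->
  forall n, (1 <= n)%N ->
  \sum_(1 <= i < n.+1) (e i - w0) + Num.sqrt n%:R / (2 * C) * D n.+1 <=
  Num.sqrt n%:R * (M / (2 * C) + C * B).
Proof.
move=> C0 B0 DM De.
have step n : (1 <= n)%N -> e n - w0 <=
    Num.sqrt n%:R / (2 * C) * (D n - D n.+1) + C * B / (2 * Num.sqrt n%:R).
  move=> n1; have := De n n1 => /=.
  have r0 : 0 < Num.sqrt (n%:R : R) by rewrite sqrtr_gt0 ltr0n.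
  move: (Num.sqrt _) r0 (e n) (D n) (D n.+1) => r r0 en dn dn' h.
  have -> : r / (2 * C) * (dn - dn') + C * B / (2 * r) =
    (dn - dn' + (C / r) ^+ 2 * B) / (2 * (C / r)).
    by field; rewrite !gt_eqF.
  have al0 : 0 < 2 * (C / r) by rewrite mulr_gt0// divr_gt0.
  rewrite ler_pdivlMr//.
  by move: (C / r) h => al h; lra.
elim=> [//|[_ _|n IH _]].
  rewrite big_nat1 sqrtr1 mul1r.
  have := step 1%N isT; have := DM 1%N isT; rewrite /= sqrtr1 mulr1 mul1r => h1 h2.
  have h3 : (2 * C)^-1 * D 1%N <= M / (2 * C).
    by rewrite mulrC ler_wpM2r// invr_ge0 mulr_ge0// ltW.
  have : 0 <= C * B by rewrite mulr_ge0// ltW.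
  by rewrite mulrBr in h2; lra.
rewrite big_nat_recr//=.
have := IH isT; have := step n.+2 isT; have := DM n.+2 isT.
have r0 : 0 < Num.sqrt (n.+1%:R : R) by rewrite sqrtr_gt0 ltr0n.
have s0 : 0 < Num.sqrt (n.+2%:R : R) by rewrite sqrtr_gt0 ltr0n.
have rs : Num.sqrt (n.+2%:R : R) ^+ 2 = Num.sqrt (n.+1%:R : R) ^+ 2 + 1.
  by rewrite !sqr_sqrtr// -natr1.
move: (Num.sqrt (n.+1%:R : R)) (Num.sqrt (n.+2%:R : R)) r0 s0 rs => r s r0 s0 rs /=.
move: (\sum_(1 <= i < n.+2) _) (D n.+2) (D n.+3) (e n.+2) => S d1 d2 e1 d1M h1 h2.
have sr : r < s by rewrite -(ltr_sqr (ltW r0) (ltW s0)) rs ltrDl.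
have CB0 : 0 <= C * B by rewrite mulr_ge0// ltW.
(* From [s ^+ 2 - r ^+ 2 = 1] and [r < s] one gets [1 / (2 s) <= 1 / (s + r) = s - r], so the noise
   terms telescope. *)
have half : C * B / (2 * s) <= (s - r) * (C * B).
  rewrite mulrC ler_wpM2r// -[leLHS]mul1r ler_pdivrMr ?mulr_gt0//; nra.
(* The induction hypothesis has [d1] with weight [r] and the new step has it with weight [s]; only
   the excess [s - r] must be bounded through [M]. *)
have h3 : (s - r) * (d1 / (2 * C)) <= (s - r) * (M / (2 * C)).
  by rewrite ler_wpM2l ?subr_ge0 ?(ltW sr)// ler_wpM2r// invr_ge0 mulr_ge0// ltW.
have -> : s * (M / (2 * C) + C * B) = r * (M / (2 * C) + C * B) +
    (s - r) * (M / (2 * C)) + (s - r) * (C * B) by ring.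
have e2 (a b : R) : a / (2 * C) * b = a * (b / (2 * C)) by rewrite mulrAC -mulrA.
by move: h1 h2 h3 half; rewrite !e2 !mulrBl mulrBr; lra.
Qed.

Section adamc.
Context {R : realType} {k p : nat}.
Context (f phi h : k.-tuple R -> R) (T : k.-tuple R -> 'rV[R]_p).
Context (Theta : set 'rV[R]_p) (C : R) (theta1 : 'rV[R]_p).
Context d (Omega : measurableType d) (P : probability Omega R).
Context (X : nat -> Omega -> k.-tuple R) (theta : nat -> Omega -> 'rV[R]_p).
Hypotheses (mT : forall i, measurable_fun setT (fun x => T x ord0 i))
  (mh : measurable_fun setT h) (h_ge0 : forall x, 0 <= h x)
  (A_gtNy : forall t, (-oo < log_normalizer T h t)%E)
  (mphi : measurable_fun setT phi) (mf : measurable_fun setT f)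
  (I_fin : (lebesgue_tuple k).-integrable setT (fun x => (phi x * f x)%:E))
  (h_gt0 : forall x, phi x * f x != 0 -> 0 < h x).
Hypotheses (Theta_sub : Theta `<=`
       interior [set t | (weight_fourth_moment T h phi f t < +oo)%E])
    (Theta_compact : compact Theta) (theta1_in : Theta theta1).
Hypothesis algo : convex_adamc T h phi f Theta C theta1 P X theta.
Implicit Types (w : Omega) (x : k.-tuple R) (n : nat).
Local Notation mu := (@lebesgue_tuple R k).
Local Notation A := (log_normalizer T h).
Local Notation q := (expfam T h).
Local Notation W := (second_moment T h phi f).
Local Notation G := (sq_gradient T h phi f).
Local Notation I := (target phi f).

(** * Feasibility of the iterates and measurability with respect to the past *)

Lemma theta_in n w : (1 <= n)%N -> Theta (theta n w).
Proof.
case: n => [//|[_|n _]]; first by rewrite (adamc_init algo).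
by have [] := adamc_update algo w (ltn0Sn n).
Qed.

Lemma theta_near n w : (1 <= n)%N -> \forall t \near theta n w, (A t < +oo)%E.
Proof. by move=> n1; apply: (Theta_near_log_normalizer Theta_sub); exact: theta_in. Qed.

Lemma theta_lty n w : (1 <= n)%N -> (A (theta n w) < +oo)%E.
Proof. by move=> n1; exact: nbhs_singleton (theta_near w n1). Qed.

(* Generators of the history, so that the past of step n can be used as a
   measurable space with carrier Omega. *)
Definition history_gen n : set (set Omega) :=
  (\bigcup_(i in [set i | (1 <= i <= n)%N])
     preimage_set_system setT (theta i : Omega -> borel_rV R p) measurable)
  `|` (\bigcup_(i in [set i | (1 <= i < n)%N])
     preimage_set_system setT (X i) measurable).

Local Notation past n := (g_sigma_algebraType (history_gen n)).

Lemma history_measurable n E : history X theta n E -> measurable E.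
Proof.
apply: smallest_sub => [|B]; first exact: sigma_algebra_measurable.
move=> [[i /andP[i1 _]]|[i /andP[i1 _]]] [D mD <-].
  exact: (adamc_measurable_theta algo i1).
exact: (adamc_measurable_X algo i1).
Qed.

Lemma measurable_to_past n : measurable_fun setT (id : Omega -> past n).
Proof. by move=> _ E hE; rewrite setTI; exact: (@history_measurable n). Qed.

Lemma measurable_theta_past n i : (1 <= i <= n)%N ->
  forall j, measurable_fun setT (fun s : past n => theta i s ord0 j).
Proof.
move=> i1n; apply: measurable_coord => _ B mB.
by apply: sub_sigma_algebra; left; exists i => //; exists B.
Qed.

Lemma measurable_X_past n i : (1 <= i < n)%N ->
  measurable_fun setT (X i : past n -> k.-tuple R).
Proof.
move=> i1n _ B mB.
by apply: sub_sigma_algebra; right; exists i => //; exists B.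
Qed.

Lemma from_past n d' (Y : measurableType d') (g : Omega -> Y) :
  measurable_fun setT (g : past n -> Y) -> measurable_fun setT g.
Proof. by move=> mg _ B mB; apply: (@history_measurable n); exact: mg. Qed.

Lemma measurable_theta n j : (1 <= n)%N ->
  measurable_fun setT (fun w => theta n w ord0 j).
Proof.
move=> n1; apply: (@from_past n); apply: measurable_theta_past.
by rewrite n1 leqnn.
Qed.

Let mq n : (1 <= n)%N ->
  measurable_fun setT (fun z : past n * k.-tuple R => q (theta n z.1) z.2).
Proof.
move=> n1; apply: (measurable_expfam_joint mT mh h_ge0 A_gtNy).
by apply: measurable_theta_past; rewrite n1 leqnn.
Qed.

(** * Integrating out the current sample *)

Section step.
Variable n : nat.
Hypothesis n1 : (1 <= n)%N.

Let eta_mixin := isMeasurableFun.Build _ _ _ _ _ (@measurable_to_past n).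
(** The conditioning variable is the identity, read as a map into the coarser sigma-algebra; the
    joint law with [X n] then captures all dependence on the past at once. *)
Let eta : {mfun Omega >-> past n} := HB.pack (id : Omega -> past n) eta_mixin.
Let Xn_mixin := isMeasurableFun.Build _ _ _ _ _ (adamc_measurable_X algo n1).
Let Xn : {mfun Omega >-> k.-tuple R} := HB.pack (X n) Xn_mixin.

Let qn (z : past n * k.-tuple R) := q (theta n z.1) z.2.
Let qn_ge0 z : 0 <= qn z. Proof. exact: expfam_ge0. Qed.
Let mqn : measurable_fun setT qn. Proof. exact: mq. Qed.

Let PE E B : measurable E -> measurable B ->
  (P (eta @^-1` E `&` Xn @^-1` B) =
  \int[P]_(w in eta @^-1` E) \int[mu]_(x in B) (qn (eta w, x))%:E)%E.
Proof. by move=> mE mB; exact: (adamc_density algo n1 mE mB). Qed.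

Lemma ge0_integral_step (F : past n * k.-tuple R -> \bar R) :
  measurable_fun setT F -> (forall z, 0 <= F z)%E ->
  (\int[P]_w F (w, X n w) =
   \int[P]_w \int[mu]_x (F (w, x) * (q (theta n w) x)%:E))%E.
Proof.
move=> mF F0.
transitivity (\int[P]_w F (eta w, Xn w))%E => //.
rewrite (ge0_integral_joint_density mqn qn_ge0 PE mF F0).
have mFq : measurable_fun setT (fun z => F z * (qn z)%:E)%E.
  by apply: emeasurable_funM => //; exact/measurable_EFinP.
have Fq0 z : (0 <= F z * (qn z)%:E)%E by rewrite mule_ge0// lee_fin.
rewrite fubini_tonelli1// ge0_integral_pushforward//.
- exact: measurable_fun_fubini_tonelli_F.
- by move=> s _; apply: integral_ge0.
Qed.

Lemma integral_step (F : past n * k.-tuple R -> \bar R) :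
  measurable_fun setT F ->
  (\int[P]_w \int[mu]_x `|F (w, x) * (q (theta n w) x)%:E| < +oo)%E ->
  (\int[P]_w F (w, X n w) =
   \int[P]_w \int[mu]_x (F (w, x) * (q (theta n w) x)%:E))%E.
Proof.
move=> mF Foo.
transitivity (\int[P]_w F (eta w, Xn w))%E => //.
rewrite (integral_joint_density mqn qn_ge0 PE mF).
have mFq : measurable_fun setT (fun z => F z * (qn z)%:E)%E.
  by apply: emeasurable_funM => //; exact/measurable_EFinP.
have mabs : measurable_fun setT (fun z => `|F z * (qn z)%:E|)%E.
  exact: measurableT_comp.
have iFq : (distribution P eta \x mu)%E.-integrable setT (fun z => F z * (qn z)%:E)%E.
  apply/integrableP; split => //.
  rewrite fubini_tonelli1// ge0_integral_pushforward//.
  - exact: measurable_fun_fubini_tonelli_F.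
  - by move=> s _; apply: integral_ge0.
rewrite -integral12_prod_meas1//.
have iF := integrable_fubini_F iFq.
rewrite (integral_pushforward (@measurable_to_past n) (measurable_int _ iF))//.
apply/integrableP; split.
  exact: (from_past (measurable_int _ iF)).
have mF' := measurable_int _ iF.
have := (integrableP _ _ _ iF).2.
rewrite ge0_integral_pushforward//.
exact: measurableT_comp.
Qed.

End step.

(** * Conditional moments of the weighted samples *)

Definition ratio n w : R := phi (X n w) * f (X n w) / q (theta n w) (X n w).

Lemma measurable_ratio_past n i : (1 <= i < n)%N ->
  measurable_fun setT (ratio i : past n -> R).
Proof.
move=> /[dup] i1n /andP[i1 i_n].
have mXi := measurable_X_past i1n.
apply: measurable_funM.
  by apply: measurable_funM; [exact: (measurableT_comp mphi mXi)|exact: (measurableT_comp mf mXi)].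
apply: measurable_funV; apply: (measurable_expfam_comp mT mh h_ge0 A_gtNy) => //.
by apply: measurable_theta_past; rewrite i1 ltnW.
Qed.

Lemma measurable_ratio n : (1 <= n)%N -> measurable_fun setT (ratio n).
Proof.
by move=> n1; apply: (@from_past n.+1); apply: measurable_ratio_past; rewrite n1/=.
Qed.

Let mcx n (g : k.-tuple R -> R) : measurable_fun setT g ->
    measurable_fun setT (fun z : past n * k.-tuple R => g z.2).
Proof. by move=> mg; exact: (measurableT_comp mg measurable_snd). Qed.

Lemma integral_ratio_sqr n : (1 <= n)%N ->
  (\int[P]_w (ratio n w ^+ 2)%:E = \int[P]_w W (theta n w))%E.
Proof.
move=> n1.
pose F (z : past n * k.-tuple R) := ((phi z.2 * f z.2 / q (theta n z.1) z.2) ^+ 2)%:E.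
transitivity (\int[P]_w F (w, X n w))%E => //.
rewrite (@ge0_integral_step n n1 F).
- apply: eq_integral => w _; apply: eq_integral => x _.
  rewrite /F /= -EFinM /weight2; congr _%:E.
  have [->|q0] := eqVneq (q (theta n w) x) 0; first by rewrite invr0 !mulr0.
  by rewrite -exprMn; field.
- apply/measurable_EFinP; apply: measurable_funX; apply: measurable_funM.
    by apply: measurable_funM; exact: mcx.
  by apply: measurable_funV; exact: mq.
- by move=> z; rewrite lee_fin sqr_ge0.
Qed.

Lemma density_neq0 t x : (A t < +oo)%E -> phi x * f x != 0 -> q t x != 0.
Proof.
by move=> At /h_gt0 hx; rewrite expfamE// mulf_neq0 ?gt_eqF// expR_gt0.
Qed.

(** Multiplying [ratio] by the density leaves [phi * f], also where the density vanishes. With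
    [U = 1] this gives unbiasedness, with a sum of earlier ratios uncorrelatedness. Fubini applies
    because the absolute double integral factors into those of [|U|] and of [|phi * f|]. *)
Lemma integral_past_ratio n (U : Omega -> R) : (1 <= n)%N ->
  measurable_fun setT (U : past n -> R) -> P.-integrable setT (EFin \o U) ->
  (\int[P]_w (U w * ratio n w)%:E = \int[P]_w (U w)%:E * I%:E)%E.
Proof.
move=> n1 mU iU.
pose F (z : past n * k.-tuple R) := (U z.1 * (phi z.2 * f z.2 / q (theta n z.1) z.2))%:E.
transitivity (\int[P]_w F (w, X n w))%E => //.
have Fq w x : (F (w, x) * (q (theta n w) x)%:E = (U w)%:E * (phi x * f x)%:E)%E.
  rewrite /F /= -!EFinM; congr _%:E.
  have [->|w0] := eqVneq (phi x * f x) 0; first by rewrite !(mul0r, mulr0).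
  by rewrite -[LHS]mulrA divfK// density_neq0// theta_lty.
have IE : (\int[mu]_x (phi x * f x)%:E = I%:E)%E.
  by rewrite /target /Rintegral fineK//; exact: integrable_fin_num.
have mF : measurable_fun setT F.
  apply/measurable_EFinP; apply: measurable_funM; first exact: (measurableT_comp mU measurable_fst).
  apply: measurable_funM.
    by apply: measurable_funM; exact: mcx.
  by apply: measurable_funV; exact: mq.
rewrite (@integral_step n n1 F mF).
  under eq_integral => w _.
    under eq_integral do rewrite Fq.
    rewrite integralZl// IE.
    over.
  by rewrite -integralZr.
under eq_integral => w _.
  under eq_integral do rewrite Fq abseM.
  rewrite ge0_integralZl//; last first.
    by apply: measurableT_comp => //; exact: measurable_int I_fin.
  over.
have [mI Ioo] := integrableP _ _ _ I_fin.
have [mU' Uoo] := integrableP _ _ _ iU.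
rewrite ge0_integralZr//.
- by rewrite lte_mul_pinfty// ?integral_ge0// ge0_fin_numE ?integral_ge0.
- exact: measurableT_comp.
- exact: integral_ge0.
Qed.

Lemma measurable_comp_past n (F : past n * k.-tuple R -> R) : (1 <= n)%N ->
  measurable_fun setT F -> measurable_fun setT (fun w => F (w, X n w)).
Proof.
move=> n1 mF.
have mj : measurable_fun setT (fun w => ((w : past n), X n w)).
  by apply: measurable_fun_pair; [exact: measurable_to_past|exact: (adamc_measurable_X algo n1)].
exact: (measurableT_comp mF mj).
Qed.

Lemma measurable_integral_past n (F : past n * k.-tuple R -> R) :
  measurable_fun setT F -> (forall z, 0 <= F z) ->
  measurable_fun setT (fun w => \int[mu]_x (F (w, x))%:E)%E.
Proof.
move=> mF F0; apply: (@from_past n).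
have := @measurable_fun_fubini_tonelli_F _ _ (past n) _ R mu (EFin \o F).
by apply => [|z]; [exact/measurable_EFinP|rewrite lee_fin].
Qed.

Lemma measurable_weight2_past n : (1 <= n)%N -> measurable_fun setT
  (fun z : past n * k.-tuple R => weight2 T h phi f (theta n z.1) z.2).
Proof.
move=> n1; apply: measurable_funM.
  by apply: measurable_funM; apply: measurable_funX; exact: mcx.
by apply: measurable_funV; exact: mq.
Qed.

Lemma measurable_sqr_amc_gradient_past n : (1 <= n)%N -> measurable_fun setT
  (fun z : past n * k.-tuple R => enorm (amc_gradient T h phi f (theta n z.1) z.2) ^+ 2).
Proof.
move=> n1; under eq_fun do rewrite sqr_enorm.
have mg i := measurable_amc_gradient_joint mT mh h_ge0 A_gtNy mphi mf
  (u := theta n : past n -> 'rV[R]_p) (measurable_theta_past _)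
  (fun s => theta_near s n1) i.
by apply: measurable_dotv => i; apply: mg; rewrite n1 leqnn.
Qed.

(** * One step of projected stochastic gradient descent *)

Hypotheses (C_gt0 : 0 < C) (Theta_convex : convex_set Theta).
Variable t0 : 'rV[R]_p.
Hypothesis t0_in : Theta t0.

Local Notation step_size n := (C / Num.sqrt n%:R).

(* The scalar product of the stochastic gradient with theta_n - t0 is bounded
   below by a difference of nonnegative terms, which makes every term of the
   inequality nonnegative. *)
Lemma descent_pointwise n w (al := step_size n) (t := theta n w) (x := X n w) :
  (1 <= n)%N ->
  enorm (theta n.+1 w - t0) ^+ 2 + 2 * al * (weight2 T h phi f t x / q t x) <=
  enorm (t - t0) ^+ 2 + 2 * al * (weight2 T h phi f t0 x / q t x)
    + al ^+ 2 * enorm (amc_gradient T h phi f t x) ^+ 2.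
Proof.
move=> n1.
have al0 : 0 <= al by rewrite divr_ge0// ?sqrtr_ge0// ltW.
have := projection_contracts Theta_convex t0_in (adamc_update algo w n1).
rewrite -/al -/t -/x !sqr_enorm.
set g := amc_gradient _ _ _ _ _ _.
have -> : t - al *: g - t0 = (t - t0) - al *: g by rewrite addrAC.
rewrite [dotv (_ - al *: g) _]dotv_sqrB (dotvZl al) !(dotvZr al).
(* The stochastic gradient is [weight2 / q] times [grad - T], so [weight2_convex] divided by [q]
   bounds exactly this product. *)
have gE : dotv (t - t0) g = weight2 T h phi f t x / q t x *
    - dotv (grad_log_normalizer T h t - T x) (t0 - t).
  rewrite /g /amc_gradient dotvZr dotvC -dotvNr opprB; congr (_ * _).
  by rewrite /weight2 -[RHS]mulrA -invfM -expr2.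
have At0 := nbhs_singleton (Theta_near_log_normalizer Theta_sub t0_in).
have := weight2_convex phi f mT mh h_ge0 A_gtNy x (theta_near w n1) At0.
rewrite -/t.
have qV : 0 <= (q t x)^-1 by rewrite invr_ge0 expfam_ge0.
move=> /(ler_wpM2r qV).
rewrite gE; move: (dotv (_ - T x) _) (dotv g g) (dotv (t - t0) _) => u v d0.
move: (dotv _ _) (weight2 _ _ _ _ t0 x) (weight2 _ _ _ _ t x) (q t x)^-1 => d1 w1 w2 qi.
move=> h1 h2.
have := ler_wpM2l al0 h1; lra.
Qed.

Variable B : R.
Hypothesis GB : forall t, Theta t -> (G t <= B%:E)%E.

Local Notation dist n := (\int[P]_w (enorm (theta n w - t0) ^+ 2)%:E)%E.
Local Notation risk n := (\int[P]_w W (theta n w))%E.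

Let measurable_dist n : (1 <= n)%N ->
  measurable_fun setT (fun w => enorm (theta n w - t0) ^+ 2).
Proof.
move=> n1; under eq_fun do rewrite sqr_enorm.
by apply: measurable_dotv => i; under eq_fun do rewrite mxE;
  apply: measurable_funD => //; exact: measurable_theta.
Qed.

(** Integrating [X_n] out against [q (theta_n)] cancels the divisors in [descent_pointwise]. The
    statement lives in the extended reals, since [risk n] is not yet known to be finite. *)
Lemma descent n (al := step_size n) : (1 <= n)%N ->
  (dist n.+1 + (2 * al)%:E * risk n <=
   dist n + (2 * al)%:E * W t0 + (al ^+ 2 * B)%:E)%E.
Proof.
move=> n1.
have al0 : 0 <= al by rewrite divr_ge0// ?sqrtr_ge0// ltW.
have al20 : 0 <= 2 * al by rewrite mulr_ge0.
pose F1 (z : past n * k.-tuple R) :=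
  weight2 T h phi f (theta n z.1) z.2 / q (theta n z.1) z.2.
pose F2 (z : past n * k.-tuple R) :=
  weight2 T h phi f t0 z.2 / q (theta n z.1) z.2.
pose F3 (z : past n * k.-tuple R) :=
  enorm (amc_gradient T h phi f (theta n z.1) z.2) ^+ 2.
have F10 z : 0 <= F1 z by rewrite divr_ge0 ?weight2_ge0 ?expfam_ge0.
have F20 z : 0 <= F2 z by rewrite divr_ge0 ?weight2_ge0 ?expfam_ge0.
have F30 z : 0 <= F3 z by rewrite sqr_ge0.
have mF1 : measurable_fun setT F1.
  apply: measurable_funM; first exact: measurable_weight2_past.
  by apply: measurable_funV; exact: mq.
have mF2 : measurable_fun setT F2.
  apply: measurable_funM; last by apply: measurable_funV; exact: mq.
  by apply: mcx; exact: measurable_weight2.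
have mF3 : measurable_fun setT F3 by exact: measurable_sqr_amc_gradient_past.
have E1 : (\int[P]_w (F1 (w, X n w))%:E = risk n)%E.
  rewrite (@ge0_integral_step n n1 (EFin \o F1)); last 2 first.
  - exact/measurable_EFinP.
  - by move=> z; rewrite lee_fin.
  apply: eq_integral => w _; apply: eq_integral => x _.
  rewrite /= -EFinM /F1 /=; congr _%:E.
  have [q0|q0] := eqVneq (q (theta n w) x) 0; last by rewrite divfK.
  by rewrite /weight2 q0 invr0 !mulr0.
have E2 : (\int[P]_w (F2 (w, X n w))%:E = W t0)%E.
  rewrite (@ge0_integral_step n n1 (EFin \o F2)); last 2 first.
  - exact/measurable_EFinP.
  - by move=> z; rewrite lee_fin.
  transitivity (\int[P]_w (cst (W t0) w))%E.
    apply: eq_integral => w _; apply: eq_integral => x _.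
    rewrite /= -EFinM /F2 /=; congr _%:E.
    (* The numerator belongs to [t0] and the divisor to [theta_n]: the cancellation needs [weight2]
       at [t0] to vanish wherever [q (theta_n)] does, which is [density_neq0]. *)
    have [w0|w0] := eqVneq (phi x * f x) 0.
      by rewrite /weight2 -exprMn w0 expr0n/= !mul0r.
    by rewrite divfK// density_neq0// theta_lty.
  exact: integral_probability_cst.
have E3 : (\int[P]_w (F3 (w, X n w))%:E <= B%:E)%E.
  rewrite (@ge0_integral_step n n1 (EFin \o F3)); last 2 first.
  - exact/measurable_EFinP.
  - by move=> z; rewrite lee_fin.
  apply: (@le_trans _ _ (\int[P]_w (cst B%:E w))%E); last first.
    by rewrite integral_probability_cst.
  apply: ge0_le_integral => //.
  - by move=> w _; apply: integral_ge0 => x _; rewrite lee_fin mulr_ge0// expfam_ge0.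
  - apply: (@measurable_integral_past n (fun z => F3 z * q (theta n z.1) z.2)).
      by apply: measurable_funM => //; exact: mq.
    by move=> z; rewrite mulr_ge0// expfam_ge0.
  - by move=> w _; exact: (GB (theta_in w n1)).
have mc1 := measurable_comp_past n1 mF1.
have mc2 := measurable_comp_past n1 mF2.
have mc3 := measurable_comp_past n1 mF3.
have md1 := measurable_dist n1; have md2 := measurable_dist (ltn0Sn n).
have := @ge0_le_integral _ _ _ P setT measurableT
  (fun w => (enorm (theta n.+1 w - t0) ^+ 2)%:E + (2 * al)%:E * (F1 (w, X n w))%:E)%E
  (fun w => ((enorm (theta n w - t0) ^+ 2)%:E + (2 * al)%:E * (F2 (w, X n w))%:E)
     + (al ^+ 2)%:E * (F3 (w, X n w))%:E)%E.
have mZ (c : R) (g : Omega -> R) : measurable_fun setT g ->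
    measurable_fun setT (fun w => c%:E * (g w)%:E)%E.
  by move=> mg; apply: emeasurable_funM => //; exact/measurable_EFinP.
have mE (g : Omega -> R) : measurable_fun setT g -> measurable_fun setT (fun w => (g w)%:E).
  by move=> mg; exact/measurable_EFinP.
have pos (g : Omega -> R) : (forall w, 0 <= g w) -> forall w, setT w -> (0 <= (g w)%:E)%E.
  by move=> g0 w _; rewrite lee_fin.
have posZ (c : R) (g : Omega -> R) : 0 <= c -> (forall w, 0 <= g w) ->
    forall w, setT w -> (0 <= c%:E * (g w)%:E)%E.
  by move=> c0 g0 w _; rewrite -EFinM lee_fin mulr_ge0.
have dpos m w : 0 <= enorm (theta m w - t0) ^+ 2 by rewrite sqr_ge0.
have f1pos w : 0 <= F1 (w, X n w) by [].
have f2pos w : 0 <= F2 (w, X n w) by [].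
have f3pos w : 0 <= F3 (w, X n w) by [].
have al2 : 0 <= al ^+ 2 by rewrite sqr_ge0.
have intZ (c : R) (g : Omega -> R) : 0 <= c -> (forall w, 0 <= g w) ->
    measurable_fun setT g ->
    (\int[P]_w (c%:E * (g w)%:E) = c%:E * \int[P]_w (g w)%:E)%E.
  move=> c0 g0 mg; rewrite ge0_integralZl//; first exact: mE.
  by move=> w _; rewrite lee_fin.
move=> le1.
have {le1} : (\int[P]_w ((enorm (theta n.+1 w - t0) ^+ 2)%:E + (2 * al)%:E * (F1 (w, X n w))%:E) <=
  \int[P]_w (((enorm (theta n w - t0) ^+ 2)%:E + (2 * al)%:E * (F2 (w, X n w))%:E)
     + (al ^+ 2)%:E * (F3 (w, X n w))%:E))%E.
  apply: le1.
  - by move=> w _; rewrite -EFinM -EFinD lee_fin addr_ge0// mulr_ge0.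
  - by apply: emeasurable_funD; [exact: mE|exact: mZ].
  - by apply: emeasurable_funD; [apply: emeasurable_funD; [exact: mE|exact: mZ]|exact: mZ].
  - move=> w _; rewrite -!EFinM -!EFinD lee_fin; exact: descent_pointwise.
rewrite (@ge0_integralD _ _ _ P _ measurableT); last 4 first.
- by move=> w _; rewrite lee_fin.
- exact: mE.
- exact: posZ.
- exact: mZ.
rewrite [leRHS](@ge0_integralD _ _ _ P _ measurableT); last 4 first.
- by move=> w _; rewrite -EFinM -EFinD lee_fin addr_ge0// mulr_ge0.
- by apply: emeasurable_funD; [exact: mE|exact: mZ].
- exact: posZ.
- exact: mZ.
rewrite (@ge0_integralD _ _ _ P _ measurableT (fun w => (enorm (theta n w - t0) ^+ 2)%:E)); last 4 first.
- by move=> w _; rewrite lee_fin.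
- exact: mE.
- exact: posZ.
- exact: mZ.
rewrite !intZ// E1 E2 => le1; apply: (le_trans le1).
by rewrite leeD2l// [leRHS]EFinM lee_wpmul2l// lee_fin.
Qed.

Lemma measurable_risk n : (1 <= n)%N -> measurable_fun setT (fun w => W (theta n w)).
Proof.
move=> n1; apply: (measurable_integral_past (measurable_weight2_past n1)) => z.
exact: weight2_ge0.
Qed.

Lemma second_moment_ge0 t : (0 <= W t)%E.
Proof. by apply: integral_ge0 => x _; rewrite lee_fin weight2_ge0. Qed.

Lemma dist_le n : (1 <= n)%N -> (dist n <= (diameter Theta ^+ 2)%:E)%E.
Proof.
move=> n1; rewrite -[leRHS](integral_probability_cst P).
apply: ge0_le_integral => //.
- by move=> w _; rewrite lee_fin sqr_ge0.
- by apply/measurable_EFinP; exact: measurable_dist.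
- move=> w _; rewrite lee_fin lerXn2r ?nnegrE ?enorm_ge0//.
    apply: le_trans (enorm_le_diameter Theta_compact t0_in t0_in).
    exact: enorm_ge0.
  by rewrite enorm_le_diameter//; exact: theta_in.
Qed.

Lemma dist_fin n : (1 <= n)%N -> dist n \is a fin_num.
Proof.
move=> n1; rewrite ge0_fin_numE; first exact: le_lt_trans (dist_le n1) (ltry _).
by apply: integral_ge0 => w _; rewrite lee_fin sqr_ge0.
Qed.

(** Read off from [descent], where the risk has a positive coefficient: the distances are bounded by
    the diameter and [W t0] is finite, so an infinite risk would violate the inequality. *)
Lemma risk_fin n : (1 <= n)%N -> risk n \is a fin_num.
Proof.
move=> n1.
have r0 : (0 <= risk n)%E by apply: integral_ge0 => w _; exact: second_moment_ge0.
rewrite ge0_fin_numE// ltey; apply/eqP => roo.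
have Wt0 : W t0 \is a fin_num.
  exact: (Theta_second_moment_fin mT mh h_ge0 A_gtNy mphi mf Theta_sub t0_in).
have al0 : (0 < (2 * step_size n)%:E)%E.
  by rewrite lte_fin mulr_gt0// divr_gt0// sqrtr_gt0 ltr0n.
have := descent n1; rewrite roo (gt0_muley al0).
move: (dist_fin n1) (dist_fin (ltn0Sn n)) Wt0.
move: W (integral P) => W0 int.
by case: (int _ _) => // a _; case: (int _ _) => // b _; case: (W0 t0).
Qed.

Lemma risk_ge (v : \bar R) n : (1 <= n)%N -> (0 <= v)%E ->
  (forall t, Theta t -> v <= W t)%E -> (v <= risk n)%E.
Proof.
move=> n1 v0 vW; rewrite -[leLHS](integral_probability_cst P).
apply: ge0_le_integral => //; first exact: measurable_risk.
by move=> w _; apply: vW; exact: theta_in.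
Qed.

(** * Mean and variance of the partial sums *)

Lemma ratio_Lfun2 n : (1 <= n)%N -> ratio n \in Lfun P 2%:E.
Proof.
move=> n1; apply: sqr_integrable_Lfun2; first exact: measurable_ratio.
by rewrite integral_ratio_sqr// -(fineK (risk_fin n1)) ltry.
Qed.

Let PT_fin : P setT \is a fin_num. Proof. exact: fin_num_measure. Qed.

Lemma expectation_ratio n : (1 <= n)%N -> 'E_P[ratio n]%E = I%:E.
Proof.
move=> n1; rewrite unlock.
have iP := finite_measure_integrable_cst P 1 measurableT.
have m1 : measurable_fun setT (cst 1 : past n -> R) by exact: measurable_cst.
transitivity (\int[P]_w (cst 1 w * ratio n w)%:E)%E.
  by apply: eq_integral => w _; rewrite /= mul1r.
rewrite (integral_past_ratio n1 m1 iP).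
by rewrite [X in (X * _)%E](integral_probability_cst P 1%:E) mul1e.
Qed.

Lemma variance_ratio n : (1 <= n)%N ->
  'V_P[ratio n]%E = (fine (risk n) - I ^+ 2)%:E.
Proof.
move=> n1; rewrite varianceE ?ratio_Lfun2// expectation_ratio//.
rewrite unlock -[X in (X - _)%E]/(\int[P]_w (ratio n w ^+ 2)%:E)%E.
by rewrite integral_ratio_sqr// EFinB (fineK (risk_fin n1)) EFin_expe.
Qed.

Definition partial_sum n w : R := \sum_(1 <= i < n.+1) ratio i w.

(** The past of step [n] contains [X_i] only for [i < n], hence the strict inequality; the case used
    is [n = m.+1]. *)
Lemma measurable_partial_sum_past m n : (m < n)%N ->
  measurable_fun setT (partial_sum m : past n -> R).
Proof.
elim: m => [_|m IH mn].
  by rewrite (_ : partial_sum 0 = cst 0)//; apply/funext => w; rewrite /partial_sum big_geq.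
have -> : partial_sum m.+1 = (partial_sum m \+ ratio m.+1)%R.
  by apply/funext => w; rewrite /partial_sum big_nat_recr.
by apply: measurable_funD; [exact: IH (ltnW mn)|exact: measurable_ratio_past].
Qed.

Lemma partial_sum_moments n : [/\ partial_sum n \in Lfun P 2%:E,
  'E_P[partial_sum n]%E = (n%:R * I)%:E &
  'V_P[partial_sum n]%E = (\sum_(1 <= i < n.+1) (fine (risk i) - I ^+ 2))%:E].
Proof.
elim: n => [|n [S2 ES VS]].
  have -> : partial_sum 0 = cst 0 by apply/funext => w; rewrite /partial_sum big_geq.
  split; first exact: Lfun_cst.
  - by rewrite expectation_cst mul0r.
  - by rewrite variance_cst big_geq.
have SE : partial_sum n.+1 = (partial_sum n \+ ratio n.+1)%R.
  by apply/funext => w; rewrite /partial_sum big_nat_recr.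
have Y2 := ratio_Lfun2 (ltn0Sn n).
have S1 := Lfun_subset12 PT_fin S2; have Y1 := Lfun_subset12 PT_fin Y2.
have SY1 : partial_sum n * ratio n.+1 \in Lfun P 1 by exact: Lfun2_mul_Lfun1.
rewrite SE; split.
- by rewrite rpredD// lee_fin ler1n.
- by rewrite expectationD// ES expectation_ratio// -EFinD -natr1 mulrDl mul1r.
(* [integral_past_ratio] with [U = partial_sum n] turns the mixed moment into the mean of the sum
   times [I], which is the product of the means. *)
have cov0 : covariance P (partial_sum n) (ratio n.+1) = 0%E.
  have iS := (Lfun1_integrable _ _).1 S1.
  rewrite covarianceE// expectation_ratio// unlock.
  rewrite -[X in (X - _)%E]/(\int[P]_w (partial_sum n w * ratio n.+1 w)%:E)%E.
  rewrite integral_past_ratio//; last exact: measurable_partial_sum_past.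
  by rewrite subee// fin_numM//; exact: integrable_fin_num.
rewrite varianceD// cov0 mule0 adde0 VS variance_ratio// -EFinD.
by rewrite [in RHS]big_nat_recr.
Qed.

End adamc.

Lemma powR32 {R : realType} (n : nat) : (n%:R : R) `^ (3 / 2) = n%:R * Num.sqrt n%:R.
Proof.
have [->|n0] := eqVneq n 0%N; first by rewrite mul0r powR0// mulf_neq0// invr_eq0.
have -> : (3 / 2 : R) = 1 + 2^-1 by field.
by rewrite powRD ?powRr1 ?powR12_sqrt// pnatr_eq0 n0 implybT.
Qed.

(** The sum splits into the regret and [n * v]. The regret is nonnegative, whence the lower bound,
    and of order [sqrt n], so division by [n ^+ 2] leaves the power [- 3 / 2]. *)
Lemma average_bounds {R : realType} (C G D v I : R) (w0 := v + I ^+ 2) (e : nat -> R) (n : nat) :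
  (1 <= n)%N -> (forall i, (1 <= i)%N -> w0 <= e i) ->
  \sum_(1 <= i < n.+1) (e i - w0) <= Num.sqrt n%:R * (D ^+ 2 / (2 * C) + C * G) ->
  n%:R^-1 * v <= n%:R^-1 ^+ 2 * \sum_(1 <= i < n.+1) (e i - I ^+ 2) <=
  n%:R^-1 * v + (D ^+ 2 / (2 * C) + C * G) * (n%:R `^ (3 / 2))^-1.
Proof.
move=> n1 e_ge le1.
have n0 : 0 < n%:R :> R by rewrite ltr0n.
have r0 : 0 < Num.sqrt (n%:R : R) by rewrite sqrtr_gt0.
have rr : Num.sqrt (n%:R : R) ^+ 2 = n%:R by rewrite sqr_sqrtr// ltW.
have sumE : \sum_(1 <= i < n.+1) (e i - I ^+ 2) =
    \sum_(1 <= i < n.+1) (e i - w0) + n%:R * v.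
  have -> : n%:R * v = \sum_(1 <= i < n.+1) v.
    by rewrite sumr_const_nat subSS subn0 mulr_natl.
  by rewrite -big_split; apply: eq_bigr => i _ /=; rewrite /w0; ring.
have sum0 : 0 <= \sum_(1 <= i < n.+1) (e i - w0).
  by rewrite big_nat_cond; apply: sumr_ge0 => i /andP[/andP[i1 _] _]; rewrite subr_ge0 e_ge.
rewrite sumE powR32; move: (\sum_(_ <= _ < _) _) sum0 le1 => S sum0 le1.
have -> : n%:R^-1 ^+ 2 * (S + n%:R * v) = n%:R^-1 ^+ 2 * S + n%:R^-1 * v.
  by field; rewrite gt_eqF.
have S0 : 0 <= n%:R^-1 ^+ 2 * S by rewrite mulr_ge0// sqr_ge0.
apply/andP; split; first by rewrite lerDr.
rewrite addrC lerD2l; move: le1; rewrite -/(w0) => le1.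
apply: le_trans (ler_wpM2l (sqr_ge0 _) le1) _.
rewrite le_eqVlt; apply/orP; left; apply/eqP.
move: (_ + C * G) (Num.sqrt n%:R) r0 rr => Q r r0 <-.
by field; rewrite !gt_eqF.
Qed.

Theorem theorem2 (R : realType) (k p : nat)
    (f phi h : k.-tuple R -> R) (T : k.-tuple R -> 'rV[R]_p)
    (Theta : set 'rV[R]_p) (C : R) (theta1 : 'rV[R]_p)
    (d : measure_display) (Omega : measurableType d) (P : probability Omega R)
    (X : nat -> Omega -> k.-tuple R) (theta : nat -> Omega -> 'rV[R]_p)
    (mf : measurable_fun setT f)
    (f_ge0 : forall x, 0 <= f x)
    (f_int1 : (\int[lebesgue_tuple k]_x (f x)%:E = 1)%E)
    (mphi : measurable_fun setT phi)
    (I_fin : (lebesgue_tuple k).-integrable setT (fun x => (phi x * f x)%:E))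
    (mT : measurable_fun setT (T : k.-tuple R -> borel_rV R p))
    (mh : measurable_fun setT h)
    (h_ge0 : forall x, 0 <= h x)
    (A_gtNy : forall t, (-oo < log_normalizer T h t)%E)
    (h_gt0 : forall x, phi x * f x != 0 -> 0 < h x)
    (Theta_sub : Theta `<=`
       interior [set t | (weight_fourth_moment T h phi f t < +oo)%E])
    (Theta_neq0 : Theta !=set0)
    (Theta_convex : convex_set Theta)
    (Theta_compact : compact Theta)
    (C_gt0 : 0 < C)
    (theta1_in : Theta theta1)
    (adamc : convex_adamc T h phi f Theta C theta1 P X theta) :
  let V := weight_variance T h phi f in
  let Vstar := min_variance T h phi f Theta in
  let D := diameter Theta in
  let G2 := max_sq_gradient T h phi f Theta in
  let I_hat := amc_estimator T h phi f X theta in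
  [/\ (exists2 t, Theta t & V t = Vstar),
      (exists t1 t2, [/\ Theta t1, Theta t2 & enorm (t1 - t2) = D]),
      (G2 < +oo)%E &
      forall n : nat, (1 <= n)%N ->
        [/\ ('E_P[I_hat n] = (target phi f)%:E)%E,
            (n%:R^-1%:E * Vstar <= 'V_P[I_hat n])%E &
            ('V_P[I_hat n] <= n%:R^-1%:E * Vstar
              + ((D ^+ 2 / (2 * C))%:E + C%:E * G2)
                * (n%:R `^ (3 / 2))^-1%:E)%E]].
Proof.
have mT' := measurable_coord mT.
have [B HB] := sq_gradient_bounded mT' mh h_ge0 A_gtNy mphi mf Theta_sub Theta_compact.
have [t0 Tt0 t0min] := second_moment_min mT' mh h_ge0 A_gtNy mphi mf Theta_sub
  Theta_neq0 Theta_compact.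
have K_lty t : Theta t -> (weight_fourth_moment T h phi f t < +oo)%E.
  exact: Theta_fourth_moment_lty.
have Wt0 := Theta_second_moment_fin mT' mh h_ge0 A_gtNy mphi mf Theta_sub Tt0.
move=> V Vstar D G2 I_hat.
(* On [Theta] the variance is the second moment minus the constant [I ^+ 2], so both have the
   minimizer [t0]. *)
have VE : V t0 = Vstar.
  apply/eqP; rewrite eq_le; apply/andP; split; last first.
    by apply: ereal_inf_lbound; exists t0.
  apply: le_ereal_inf_tmp => _ [t Tt <-].
  rewrite /V (weight_varianceE (K_lty _ Tt0)) (weight_varianceE (K_lty _ Tt)).
  by move: (t0min t Tt); move: (second_moment T h phi f) => W le1; rewrite leeB.
have G2_ub t : Theta t -> (sq_gradient T h phi f t <= G2)%E.
  by move=> Tt; apply: ereal_sup_ubound; exists t.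
have G2_ge0 : (0 <= G2)%E.
  apply: le_trans (G2_ub _ Tt0); apply: integral_ge0 => x _.
  by rewrite lee_fin mulr_ge0 ?sqr_ge0// expfam_ge0.
have G2_lty : (G2 < +oo)%E.
  apply: le_lt_trans (ltry B); apply: ge_ereal_sup => _ [t Tt <-]; exact: HB.
split => //; [by exists t0|exact: diameter_attained|].
have G2E : G2 = (fine G2)%:E by rewrite fineK// ge0_fin_numE.
(* The descent is run with the supremum itself as its bound; the bound [B] from compactness only
   shows that this supremum is finite. *)
have HG t : Theta t -> (sq_gradient T h phi f t <= (fine G2)%:E)%E.
  by rewrite -G2E; exact: G2_ub.
have G2r : 0 <= fine G2 by rewrite fine_ge0.
pose e n := fine (\int[P]_w second_moment T h phi f (theta n w))%E.
pose dist n := fine (\int[P]_w (enorm (theta n w - t0) ^+ 2)%:E)%E.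
pose w0 := fine (second_moment T h phi f t0).
have eE n : (1 <= n)%N -> (e n)%:E = (\int[P]_w second_moment T h phi f (theta n w))%E.
  move=> n1; rewrite fineK//; exact: (risk_fin mT' mh h_ge0 A_gtNy mphi mf h_gt0
    Theta_sub Theta_compact theta1_in adamc C_gt0 Theta_convex Tt0 HG).
have distE n : (1 <= n)%N ->
    (dist n)%:E = (\int[P]_w (enorm (theta n w - t0) ^+ 2)%:E)%E.
  by move=> n1; rewrite fineK//; exact: (dist_fin Theta_compact theta1_in adamc).
have w0E : w0%:E = second_moment T h phi f t0 by rewrite fineK.
have e_ge n : (1 <= n)%N -> w0 <= e n.
  move=> n1; rewrite -lee_fin (eE _ n1) w0E.
  apply: (risk_ge mT' mh h_ge0 A_gtNy mphi mf theta1_in adamc n1) => //.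
  exact: second_moment_ge0.
have dist_D n : (1 <= n)%N -> dist n <= D ^+ 2.
  by move=> n1; rewrite -lee_fin (distE _ n1); exact: (dist_le Theta_compact theta1_in adamc).
have step n : (1 <= n)%N -> dist n.+1 + 2 * (C / Num.sqrt n%:R) * e n <=
    dist n + 2 * (C / Num.sqrt n%:R) * w0 + (C / Num.sqrt n%:R) ^+ 2 * fine G2.
  move=> n1; have := descent mT' mh h_ge0 A_gtNy mphi mf h_gt0 Theta_sub theta1_in
    adamc C_gt0 Theta_convex Tt0 HG n1.
  by rewrite -(eE _ n1) -(distE _ n1) -(distE _ (ltn0Sn n)) -w0E -!EFinM -!EFinD lee_fin.
have VstarE : Vstar = (w0 - target phi f ^+ 2)%:E.
  by rewrite -VE /V weight_varianceE; [rewrite EFinB w0E|exact: K_lty].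
move=> n n1.
have [S2 ES VS] := partial_sum_moments mT' mh h_ge0 A_gtNy mphi mf I_fin h_gt0
  Theta_sub Theta_compact theta1_in adamc C_gt0 Theta_convex Tt0 HG n.
have P_fin : P setT \is a fin_num by exact: fin_num_measure.
have S1 := Lfun_subset12 P_fin S2.
have IE : I_hat n = (n%:R^-1 \o* partial_sum f phi h T X theta n)%R.
  by apply/funext => w; rewrite /= mulrC.
have VI : ('V_P[I_hat n] = (n%:R^-1 ^+ 2 *
    \sum_(1 <= i < n.+1) (e i - target phi f ^+ 2))%:E)%E.
  by rewrite IE varianceZ// VS -EFinM.
have sum_le : \sum_(1 <= i < n.+1) (e i - w0) <=
    Num.sqrt n%:R * (D ^+ 2 / (2 * C) + C * fine G2).
  have := descent_sum C_gt0 G2r dist_D step n1; apply: le_trans.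
  (* The leftover term in [dist n.+1] is nonnegative and is dropped. *)
  rewrite lerDl mulr_ge0 ?divr_ge0 ?sqrtr_ge0 ?mulr_ge0 ?(ltW C_gt0)//.
  by rewrite -lee_fin distE// integral_ge0// => w _; rewrite lee_fin sqr_ge0.
have := @average_bounds R C (fine G2) D (w0 - target phi f ^+ 2) (target phi f) e n n1.
rewrite subrK => /(_ e_ge sum_le) /andP[lo up].
split.
- by rewrite IE expectationZl// ES -EFinM mulrA mulVf ?mul1r// pnatr_eq0 -lt0n.
- by rewrite VI VstarE -EFinM lee_fin.
- by rewrite VI VstarE G2E -!EFinD lee_fin.
Qed.
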